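(* For all constants $c,s\in(0,1)$ with $s<c$, there exists a constant $s'\in(0,1)$ (depending only on $c,s$) such that for all integer-valued functions $r(\cdot),q(\cdot)$, $$\mathrm{PCP}_{c,s}[r,q]\subseteq \mathrm{PCP}_{1,s'}[r,\,q+O_{s,c}(r)].$$ Furthermore, if the proof size of the original PCP is $n$, then the proof size of the resulting PCP is $n+O(2^r)$.
   Context: A verifier is $(r,q)$-restricted if on every input of length $n$ it tosses at most $r(n)$ coins and non-adaptively queries at most $q(n)$ bits of a proof string (oracle). For integer-valued $r(\cdot),q(\cdot)$ and $c(\cdot),s(\cdot)$ with values in $[0,1]$, $\mathrm{PCP}_{c,s}[r,q]$ is the class of languages $L$ for which there is an $(r,q)$-restricted non-adaptive verifier $V$ such that: (completeness) for every $x\in L$ there is a proof $\pi$ with $\Pr[V^\pi(x)\text{ accepts}]\ge c$; (soundness) for every $x\notin L$ and every proof $\pi$, $\Pr[V^\pi(x)\text{ accepts}]\le s$ (probabilities over the verifier's coins). The proof size is the length of the proof string $\pi$. $O_{s,c}(\cdot)$ hides a constant depending only on $s,c$. *)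

(* Defs.v *)
From HB Require Import structures.
From mathcomp Require Import all_boot all_order all_algebra.
From mathcomp Require Import reals.

Set Implicit Arguments.
Unset Strict Implicit.
Unset Printing Implicit Defensive.

Import Order.TTheory GRing.Theory Num.Theory.

(* Deterministic multi-tape Turing machines, with tape alphabet
   {0, 1, #, blank}. *)

(* [Some b] is the bit [b]; [None] is the separator #. *)
Definition symbol := option bool.

(* [None] is the blank. *)
Definition cell := option symbol.

Variant move := MoveLeft | Stay | MoveRight.

(* A two-way infinite tape: the cells to the left of the head (nearest first),
   the scanned cell, and the cells to the right of the head (nearest first).
   All cells not listed are blank. *)
Record tape := Tape { tleft : seq cell; tcur : cell; tright : seq cell }.

Definition blank_tape : tape := Tape [::] None [::].

Definition write (a : cell) (t : tape) : tape := Tape (tleft t) a (tright t).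

Definition shift (m : move) (t : tape) : tape :=
  match m with
  | MoveLeft => Tape (behead (tleft t)) (head None (tleft t))
                     (tcur t :: tright t)
  | Stay => t
  | MoveRight => Tape (tcur t :: tleft t) (head None (tright t))
                      (behead (tright t))
  end.

(* A machine with [extra_tapes.+1] tapes; [delta q a = None] means that the
   machine halts in state [q] when it scans the symbols [a]. *)
Record TM := MkTM {
  extra_tapes : nat;
  state : finType;
  start : state;
  delta : state -> {ffun 'I_extra_tapes.+1 -> cell} ->
          option (state * {ffun 'I_extra_tapes.+1 -> cell * move}) }.

Record config (M : TM) := Config {
  cstate : state M;
  ctapes : {ffun 'I_(extra_tapes M).+1 -> tape} }.

Definition step (M : TM) (k : config M) : option (config M) :=
  if delta (cstate k) [ffun i => tcur (ctapes k i)] is Some (q, act) then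
    Some (Config q [ffun i => shift (act i).2 (write (act i).1 (ctapes k i))])
  else None.

Fixpoint run (M : TM) (t : nat) (k : config M) : config M :=
  if t is t'.+1 then
    if step k is Some k' then run t' k' else k
  else k.

Definition input_tape (w : seq symbol) : tape :=
  Tape [::] (head None (map Some w)) (behead (map Some w)).

(* Tape 0 carries the input, with the head on its first symbol. *)
Definition init (M : TM) (w : seq symbol) : config M :=
  Config (start M) [ffun i => if i == ord0 then input_tape w else blank_tape].

Fixpoint nonblank_prefix (s : seq cell) : seq symbol :=
  if s is Some a :: s' then a :: nonblank_prefix s' else [::].

(* The output is the word on tape 0 which starts at the head and extends to the
   first blank. *)
Definition output (M : TM) (k : config M) : seq symbol :=
  let t := ctapes k ord0 in nonblank_prefix (tcur t :: tright t).

Definition computes_within (M : TM) (w v : seq symbol) (t : nat) : Prop :=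
  step (run t (init M w)) = None /\ output (run t (init M w)) = v.

(* The list of bit strings w_1, ..., w_k is written w_1 # ... w_k #. *)
Definition encode (l : seq (seq bool)) : seq symbol :=
  flatten [seq rcons (map Some w) None | w <- l].

Definition poly_time (A B : Type) (inp : A -> seq (seq bool))
    (out : B -> seq (seq bool)) (f : A -> B) : Prop :=
  exists (M : TM) (C d : nat), forall a : A,
    computes_within M (encode (inp a)) (encode (out (f a)))
      (C * size (encode (inp a)) ^ d + C).

(* On input x a non-adaptive verifier tosses [coins x] coins; with outcome w it
   queries the proof at the positions [queries x w], which by non-adaptivity
   depend on x and w only; given the list a of the answers, it accepts iff
   [decide x w a]. Positions are written in binary, see [position]. *)
Record verifier := Verifier {
  coins : seq bool -> nat;
  queries : seq bool -> seq bool -> seq (seq bool);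
  decide : seq bool -> seq bool -> seq bool -> bool }.

(* The number of coins is output in unary, so it is polynomially bounded and
   the running times below are polynomial in the length of x. *)
Definition efficient (V : verifier) : Prop :=
  [/\ poly_time (fun x => [:: x]) (fun k => [:: nseq k true]) (coins V),
      poly_time (fun xw : seq bool * seq bool => [:: xw.1; xw.2]) id
        (fun xw => queries V xw.1 xw.2)
    & poly_time
        (fun xwa : seq bool * seq bool * seq bool =>
           [:: xwa.1.1; xwa.1.2; xwa.2])
        (fun b : bool => [:: [:: b]])
        (fun xwa => decide V xwa.1.1 xwa.1.2 xwa.2)].

(* Binary value, least significant bit first. *)
Definition position (a : seq bool) : nat :=
  foldr (fun (b : bool) n => b + n.*2) 0 a.

Definition accepts (V : verifier) (x pi w : seq bool) : bool :=
  decide V x w [seq nth false pi (position a) | a <- queries V x w].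

Definition restricted (V : verifier) (r q : nat -> nat) : Prop :=
  forall x : seq bool,
    coins V x <= r (size x) /\
    (forall w : (coins V x).-tuple bool,
       size (queries V x w) <= q (size x)).

(* [ell n] is the length of the proof strings for inputs of length n. *)
Definition has_proof_size (V : verifier) (ell : nat -> nat) : Prop :=
  forall (x : seq bool) (w : (coins V x).-tuple bool) (a : seq bool),
    a \in queries V x w -> position a < ell (size x).

Local Open Scope ring_scope.

Definition acceptance_prob (R : realType) (V : verifier) (x pi : seq bool) : R :=
  #|[set w : (coins V x).-tuple bool | accepts V x pi w]|%:R
    / 2 ^+ coins V x.

Definition language := seq bool -> Prop.

Definition PCP_size (R : realType) (c s : nat -> R) (r q ell : nat -> nat)
    (L : language) : Prop :=
  exists V : verifier,
    [/\ efficient V,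
        restricted V r q,
        has_proof_size V ell,
        forall x, L x ->
          exists2 pi : seq bool, size pi = ell (size x) &
            c (size x) <= acceptance_prob R V x pi
      & forall x, ~ L x ->
          forall pi : seq bool, size pi = ell (size x) ->
            acceptance_prob R V x pi <= s (size x)].

Definition PCP (R : realType) (c s : nat -> R) (r q : nat -> nat)
    (L : language) : Prop :=
  exists ell : nat -> nat, PCP_size c s r q ell L.

(* Main.v *)
From HB Require Import structures.
Require Import Defs.
From mathcomp Require Import all_boot all_order all_algebra.
From mathcomp Require Import reals.
From mathcomp Require Import ring lra zify.

Set Implicit Arguments.
Unset Strict Implicit.
Unset Printing Implicit Defensive.

Import Order.TTheory GRing.Theory Num.Theory.

(* For each coin sequence w of length k the new proof holds a bit z_w, claiming
   that V accepts on w. To certify that a c-fraction of these bits are 1, group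
   the w by all but their first b bits, the groups being the vertices of an
   expander of constant degree, and let the proof also describe a flow of tokens
   along its edges, with a bounded number of tokens per edge. The new verifier
   checks that z_w = 1 implies that V accepts on w, and that in the group of w
   the number of ones plus the net inflow reaches a threshold theta ~ c 2^b.
   Soundness: net inflows sum to zero, so if few w reject, then the bits z_w,
   and hence the acceptance probability of V, are on average nearly theta / 2^b,
   which exceeds s.
   Completeness: when the average is at least theta, a flow balancing all groups
   exists, since by expansion no cut is saturated.

   The expander has vertex set F_2^D; its 8 generators are involutions, 4 of them
   linear (y_j += y_(j-1) or y_(j-3) for j of a given parity) and 4 translations,
   all computable by finite automata. In the Walsh basis a linear generator maps
   the character z to its transpose, z_j += z_(j+s); for most generators this
   lowers the least j with z_j = 1, until some j < 3 is reached and a translation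
   acts by -1. This gives a spectral gap.

   The original proof is stored after the 2^(k+8) new bits, so its positions are
   shifted by 2^(k+8); no bound on its length is needed to compute the queries. *)

(** * Orienting tokens in a graph *)

Section Orientation.
Variables (V T : finType) (dem : V -> nat).

Definition touching (A : T -> {set V}) (S : {set V}) : nat :=
  \sum_t ~~ [disjoint A t & S].

(** Hall's condition with demands: token [t] may go to any vertex of [A t], and vertex [v] must
    receive [dem v] tokens. *)
Definition hall (A : T -> {set V}) : Prop :=
  forall S : {set V}, \sum_(v in S) dem v <= touching A S.

Definition restrict (A : T -> {set V}) t v : T -> {set V} :=
  fun t' => if t' == t then [set v] else A t'.

Lemma touchingD1 A t S :
  touching A S = ~~ [disjoint A t & S] + \sum_(t' | t' != t) ~~ [disjoint A t' & S].
Proof. by rewrite /touching (bigD1 t). Qed.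

Lemma touching_restrict A t v S :
  touching (restrict A t v) S =
  (v \in S) + \sum_(t' | t' != t) ~~ [disjoint A t' & S].
Proof.
rewrite (touchingD1 _ t) /restrict eqxx disjoints1 negbK; congr (_ + _).
by apply: eq_bigr => t' /negPf->.
Qed.

Lemma disjoint_submod (A S S' : {set V}) :
  ~~ [disjoint A & S :|: S'] + ~~ [disjoint A & S :&: S'] <=
  ~~ [disjoint A & S] + ~~ [disjoint A & S'].
Proof.
have dU : [disjoint A & S :|: S'] = [disjoint A & S] && [disjoint A & S'].
  by rewrite -!setI_eq0 setIUr setU_eq0.
have dI : [disjoint A & S] || [disjoint A & S'] -> [disjoint A & S :&: S'].
  by case/orP; apply: disjointWr; rewrite ?subsetIl ?subsetIr.
rewrite dU; move: dI.
by case: [disjoint A & S]; case: [disjoint A & S'];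
  case: [disjoint A & S :&: S'] => //= /(_ isT).
Qed.

Lemma touch_set2 (u v : V) (S : {set V}) :
  ~~ [disjoint [set u; v] & S] = (u \in S) || (v \in S).
Proof. by rewrite -setI_eq0 setIUl setU_eq0 !setI_eq0 !disjoints1 -negb_or negbK. Qed.

Lemma sum_setUI (S S' : {set V}) :
  \sum_(v in S) dem v + \sum_(v in S') dem v =
  \sum_(v in S :|: S') dem v + \sum_(v in S :&: S') dem v.
Proof.
rewrite [\sum_(v in S) _]big_mkcond [\sum_(v in S') _]big_mkcond /=.
rewrite [\sum_(v in S :|: S') _]big_mkcond [\sum_(v in S :&: S') _]big_mkcond /=.
rewrite -!big_split /=.
apply: eq_bigr => v _; rewrite !inE.
by case: (v \in S); case: (v \in S'); rewrite /= ?addn0 ?add0n.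
Qed.

(* Rado's argument: two tight sets witnessing that neither endpoint may be
   dropped contradict the submodularity of [touching]. *)
Lemma hall_restrict A t u v :
  hall A -> A t = [set u; v] -> hall (restrict A t u) \/ hall (restrict A t v).
Proof.
move=> hA At.
case: (boolP [forall S : {set V}, \sum_(v in S) dem v <= touching (restrict A t u) S]).
  by move/forallP=> h; left.
case/forallPn=> S; rewrite -ltnNge touching_restrict => hS.
case: (boolP [forall S : {set V}, \sum_(v in S) dem v <= touching (restrict A t v) S]).
  by move/forallP=> h; right.
case/forallPn=> S'; rewrite -ltnNge touching_restrict => hS'.
exfalso.
have dAt (X : {set V}) : ~~ [disjoint A t & X] = (u \in X) || (v \in X).
  by rewrite At touch_set2.
(* [S] contains [v] but not [u], and [S'] contains [u] but not [v]. Thus [t] counts once for the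
   union and not at all for the intersection, but twice for [S] and [S'], while the other tokens are
   submodular. *)
have := hA S; have := hA S'; have := hA (S :|: S'); have := hA (S :&: S').
rewrite !(touchingD1 _ t) !dAt !inE.
have := sum_setUI S S'.
have : \sum_(t' | t' != t) ~~ [disjoint A t' & S :|: S'] +
       \sum_(t' | t' != t) ~~ [disjoint A t' & S :&: S'] <=
       \sum_(t' | t' != t) ~~ [disjoint A t' & S] +
       \sum_(t' | t' != t) ~~ [disjoint A t' & S'].
  by rewrite -!big_split; apply: leq_sum => t' _; apply: disjoint_submod.
move: hS hS'; case: (u \in S); case: (v \in S); case: (u \in S'); case: (v \in S') => /=;
  rewrite ?add0n ?add1n; lia.
Qed.

(** Tokens are committed to one endpoint at a time, keeping Hall's condition; once every set is a
    singleton, Hall's condition for [[set v]] is the claim. *)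
Lemma orientation (a b : T -> V) :
  (forall S : {set V},
     \sum_(v in S) dem v <= \sum_t ((a t \in S) || (b t \in S))) ->
  exists o : T -> bool,
    forall v, dem v <= \sum_t ((if o t then b t else a t) == v).
Proof.
move=> h.
pose A (o : T -> option bool) t :=
  if o t is Some c then [set if c then b t else a t] else [set a t; b t].
suff [o ho] : exists o : T -> bool, hall (A (fun t => Some (o t))).
  exists o => v; have := ho [set v]; rewrite big_set1 => /leq_trans; apply.
  by apply: leq_sum => t _; rewrite /A disjoints1 negbK inE eq_sym.
(* [None] marks a token that is still free; the induction commits the tokens of [enum T] one by
   one. *)
suff [o ho oN] : exists2 o : T -> option bool,
    hall (A o) & forall t, t \in enum T -> o t != None.
  exists (fun t => odflt false (o t)) => S; apply: leq_trans (ho S) _.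
  apply/eq_leq/eq_bigr => t _; congr (nat_of_bool (~~ _)).
  by rewrite /A; have := oN t (mem_enum _ t); case: (o t).
elim: (enum T) => [|t s [o ho os]].
  exists (fun=> None) => // S; apply: leq_trans (h S) _.
  by apply: leq_sum => t _; rewrite /A touch_set2.
have [ot|ot] := boolP (o t == None); last first.
  by exists o => // t'; rewrite inE => /predU1P[->|/os].
have [] := @hall_restrict _ t (a t) (b t) ho; rewrite ?/A ?(eqP ot) // => h'.
  exists (fun t' => if t' == t then Some false else o t').
    move=> S; apply: leq_trans (h' S) _; apply/eq_leq/eq_bigr => t' _.
    by rewrite /restrict; case: eqP => [->|].
  by move=> t'; rewrite inE; case: eqP => //= _ /os.
exists (fun t' => if t' == t then Some true else o t').
  move=> S; apply: leq_trans (h' S) _; apply/eq_leq/eq_bigr => t' _.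
  by rewrite /restrict; case: eqP => [->|].
by move=> t'; rewrite inE; case: eqP => //= _ /os.
Qed.
End Orientation.

(** * An expander computed by finite automata *)

(* [(true, p, q)] is the linear generator y_j += y_(j-s) for odd j = p, where
   s = 3 or 1 according to q; [(false, p, q)] flips the bit of index 2p + q. *)
Definition gen := (bool * bool * bool)%type.
Definition gshift (g : gen) : nat := if g.2 then 3 else 1.
Definition gcoord (g : gen) : nat := g.1.2.*2 + g.2.

Definition gadj (g : gen) (j : nat) (h1 h3 : bool) : bool :=
  if g.1.1 then (odd j == g.1.2) && (if g.2 then h3 else h1)
  else j == gcoord g.

(** The last three bits read are carried along, nearest first, so one pass with finite memory
    applies the generator; bits before the start count as [false]. *)
Fixpoint gscan (g : gen) (j : nat) (h1 h2 h3 : bool) (v : seq bool) : seq bool :=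
  if v is c :: v' then (c (+) gadj g j h1 h3) :: gscan g j.+1 c h1 h2 v'
  else [::].

Definition gact (g : gen) (v : seq bool) : seq bool :=
  gscan g 0 false false false v.

Lemma size_gscan g j h1 h2 h3 v : size (gscan g j h1 h2 h3 v) = size v.
Proof. by elim: v j h1 h2 h3 => //= c v IH j h1 h2 h3; rewrite IH. Qed.

Lemma size_gact g v : size (gact g v) = size v.
Proof. exact: size_gscan. Qed.

Lemma gactE g v :
  gact g v = mkseq (fun j => nth false v j (+)
    gadj g j ((0 < j) && nth false v (j - 1)) ((2 < j) && nth false v (j - 3))) (size v).
Proof.
pose h (p : seq bool) n := nth false (rev p) n.
(* Generalised over the prefix [p] already scanned, whose last three bits form the history. *)
suff scanE p : gscan g (size p) (h p 0) (h p 1) (h p 2) v =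
    mkseq (fun i => let j := size p + i in nth false (p ++ v) j (+)
      gadj g j ((0 < j) && nth false (p ++ v) (j - 1))
               ((2 < j) && nth false (p ++ v) (j - 3))) (size v).
  exact: (scanE [::]).
elim: v p => [//|c v IH] p /=.
rewrite /mkseq /= (iotaDl 1 0) -map_comp; congr (_ :: _).
  rewrite !addn0 nth_cat ltnn subnn /=; congr (_ (+) gadj _ _ _ _).
    rewrite /h; case: (posnP (size p)) => [/size0nil->//|p0].
    by rewrite nth_rev // nth_cat ltn_subrL p0.
  rewrite /h; case: (ltnP 2 (size p)) => [p2|p2].
    by rewrite nth_rev // nth_cat ltn_subrL (ltn_trans _ p2).
  by rewrite nth_default ?size_rev.
rewrite /h; have := IH (rcons p c); rewrite /h size_rcons rev_rcons /= => ->.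
by apply/eq_map => i /=; rewrite addSnnS cat_rcons addnS.
Qed.

Lemma nth_gact g v j : j < size v ->
  nth false (gact g v) j = nth false v j (+)
    (if g.1.1 then [&& odd j == g.1.2, gshift g <= j & nth false v (j - gshift g)]
     else j == gcoord g).
Proof.
move=> jv; rewrite gactE nth_mkseq // /gadj /gshift.
by case: g => -[[] p] [].
Qed.

(** Both shifts are odd, so a linear generator reads only coordinates of the parity that it leaves
    fixed, and applying it twice adds the same bit twice. *)
Lemma gactK g : involutive (gact g).
Proof.
move=> v; apply: (@eq_from_nth _ false); rewrite !size_gact // => j jv.
have jsv : j - gshift g < size v by apply: leq_ltn_trans jv; apply: leq_subr.
rewrite !nth_gact ?size_gact //; case: g.1.1; last by rewrite -addbA addbb addbF.
case: (odd j =P g.1.2) => [oj|_] /=; last by rewrite !addbF.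
case: (leqP (gshift g) j) => [sj|_] /=; last by rewrite !addbF.
have -> : (odd (j - gshift g) == g.1.2) = false.
  by rewrite oddB // oj /gshift; case: g.2; case: g.1.2.
by rewrite addbF -addbA addbb addbF.
Qed.

(** * Big operators over tuples *)

Section Big.
Variables (R : Type) (idx : R) (op : Monoid.com_law idx).

Lemma big_tuple0 (T : finType) (F : seq T -> R) :
  \big[op/idx]_(t : 0.-tuple T) F t = F [::].
Proof.
rewrite (big_pred1 [tuple]) // => t /=.
by rewrite (tuple0 t); apply/esym/eqP.
Qed.

Lemma big_tupleS (T : finType) n (F : seq T -> R) :
  \big[op/idx]_(t : n.+1.-tuple T) F t =
  \big[op/idx]_(a : T) \big[op/idx]_(t : n.-tuple T) F (a :: t).
Proof.
rewrite pair_big /= (reindex (fun p : T * n.-tuple T => [tuple of p.1 :: p.2])) //=.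
exists (fun t : n.+1.-tuple T => (thead t, [tuple of behead t])) => [[a t] _|t _] /=.
  by congr (_, _); apply: val_inj.
by rewrite -tuple_eta.
Qed.

Lemma big_tuple_cat (T : finType) m n (F : seq T -> R) :
  \big[op/idx]_(t : (m + n).-tuple T) F t =
  \big[op/idx]_(u : m.-tuple T) \big[op/idx]_(v : n.-tuple T) F (u ++ v).
Proof.
elim: m F => [|m IH] F; first by rewrite (big_tuple0 (fun u => \big[op/idx]_v F (u ++ tval v))).
rewrite addSn big_tupleS.
rewrite (big_tupleS m (fun u => \big[op/idx]_(v : n.-tuple T) F (u ++ v))).
by apply: eq_bigr => a _; rewrite (IH (fun t => F (a :: t))).
Qed.
End Big.

(** * Walsh analysis and the spectral gap *)

Section Expansion.
Local Open Scope ring_scope.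
Variable D : nat.
Implicit Types (x y z : D.-tuple bool) (S : {set D.-tuple bool}).

Lemma gact_tupleP g x : size (gact g x) == D.
Proof. by rewrite size_gact size_tuple. Qed.
Canonical gact_tuple g x := Tuple (gact_tupleP g x).

Lemma gact_tupleK g : involutive (gact_tuple g).
Proof. by move=> x; apply: val_inj; rewrite /= gactK. Qed.

Definition bit (s : seq bool) (j : nat) := nth false s j.

(** The transpose of the linear part of [gact g], hence the identity for a translation. *)
Definition gdual (g : gen) z : D.-tuple bool :=
  [tuple bit z j (+) [&& g.1.1, odd (j + gshift g) == g.1.2 & bit z (j + gshift g)] | j < D].

Lemma bit_out z j : (D <= j)%N -> bit z j = false.
Proof. by move=> h; rewrite /bit nth_default // size_tuple. Qed.

Lemma bit_gdual g z j :
  bit (gdual g z) j = bit z j (+) [&& g.1.1, odd (j + gshift g) == g.1.2 & bit z (j + gshift g)].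
Proof.
have [jD|jD] := ltnP j D; last first.
  by rewrite !bit_out ?andbF // (leq_trans jD) // leq_addr.
by rewrite /bit (nth_map (Ordinal jD)) ?size_enum_ord // nth_enum_ord.
Qed.

Lemma eq_bit x y : (forall j, (j < D)%N -> bit x j = bit y j) -> x = y.
Proof.
by move=> h; apply: val_inj; apply: (@eq_from_nth _ false); rewrite !size_tuple // => j /h.
Qed.

Lemma gdualK g : involutive (gdual g).
Proof.
move=> z; apply: eq_bit => j _; rewrite !bit_gdual.
case: g.1.1 => /=; last by rewrite !addbF.
case: eqP => [e|] /=; last by rewrite !addbF.
have -> : (odd (j + gshift g + gshift g) == g.1.2) = false.
  by rewrite oddD e /gshift; case: g.2; case: g.1.2.
by rewrite addbF -addbA addbb addbF.
Qed.

Definition walsh z x : rat := \prod_(j < D) (-1) ^+ (bit z j && bit x j).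

Lemma walsh_gact g z x :
  walsh z (gact_tuple g x) =
  walsh (gdual g z) x * (if g.1.1 then 1 else (-1) ^+ bit z (gcoord g)).
Proof.
have bitg j : (j < D)%N -> bit (gact_tuple g x) j = bit x j (+)
    (if g.1.1 then [&& odd j == g.1.2, (gshift g <= j)%N & bit x (j - gshift g)]
     else j == gcoord g).
  by move=> jD; rewrite /bit /= nth_gact ?size_tuple.
rewrite /walsh; under eq_bigr do rewrite bitg // andb_addr signr_addb.
under [in RHS]eq_bigr do rewrite bit_gdual andb_addl signr_addb.
rewrite !big_split /= -mulrA; congr (_ * _).
case: g.1.1 => /=; last first.
  rewrite [X in _ = X * _]big1 ?mul1r; last by [].
  have [cD|cD] := ltnP (gcoord g) D; last first.
    rewrite bit_out // big1 // => j _.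
    by rewrite ltn_eqF ?andbF // (leq_trans _ cD).
  rewrite (bigD1 (Ordinal cD)) //= eqxx andbT big1 ?mulr1 // => j.
  by rewrite -val_eqE /= => /negPf->; rewrite andbF.
rewrite mulr1; set s := gshift g.
have -> : \prod_(j < D) (-1) ^+ (bit z j && [&& odd j == g.1.2, (s <= j)%N & bit x (j - s)]) =
          \prod_(0 <= j < D) (-1) ^+ (bit z j && [&& odd j == g.1.2, (s <= j)%N & bit x (j - s)]) :> rat.
  by rewrite big_mkord.
have -> : \prod_(j < D) (-1) ^+ ((odd (j + s) == g.1.2) && bit z (j + s) && bit x j) =
          \prod_(0 <= j < D) (-1) ^+ ((odd (j + s) == g.1.2) && bit z (j + s) && bit x j) :> rat.
  by rewrite big_mkord.
have [sD|sD] := leqP s D; last first.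
  rewrite [LHS]big_nat [LHS]big1 => [|j jD].
    by rewrite big_nat big1 // => j jD; rewrite (@bit_out z (j + s)) ?andbF //; lia.
  by rewrite leqNgt (_ : (j < s)%N) ?andbF //; lia.
(* The first [s] factors on the left and the last [s] on the right are 1; the others agree after
   shifting the index by [s]. *)
rewrite (big_cat_nat (n := s)) //= big_nat big1 ?mul1r; last first.
  by move=> j /andP[_ js]; rewrite leqNgt js ?andbF.
rewrite [RHS](big_cat_nat (n := D - s)) ?leq_subr //=.
rewrite [X in _ = _ * X]big_nat [X in _ = _ * X]big1 ?mulr1; last first.
  by move=> j js; rewrite (@bit_out z (j + s)) ?andbF //; lia.
rewrite -{1}[s]add0n big_addn; apply: eq_bigr => j _.
by rewrite leq_addl addnK; congr (_ ^+ nat_of_bool _); case: bit; case: eqP; case: bit.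
Qed.

Lemma sum_tuple_prod n (h : nat -> bool -> rat) :
  \sum_(z : n.-tuple bool) \prod_(j < n) h j (bit z j) =
  \prod_(j < n) (h j false + h j true).
Proof.
elim: n h => [|n IH] h.
  by rewrite (big_tuple0 _ (fun t => \prod_(j < 0) h j (bit t j))) !big_ord0.
rewrite (big_tupleS _ n (fun t => \prod_(j < n.+1) h j (bit t j))).
rewrite big_bool /= big_ord_recl -(IH (fun j => h j.+1)) mulrDl addrC.
by congr (_ + _); rewrite mulr_sumr; apply: eq_bigr => z _; rewrite big_ord_recl.
Qed.

(** The sum factors over the coordinates, and one where [x] and [y] differ contributes 1 - 1 = 0. *)
Lemma walsh_orth x y : \sum_z walsh z x * walsh z y = if x == y then 2 ^+ D else 0.
Proof.
pose h j c : rat := (-1) ^+ (c && (bit x j (+) bit y j)).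
transitivity (\sum_(z : D.-tuple bool) \prod_(j < D) h j (bit z j)).
  apply: eq_bigr => z _; rewrite /walsh -big_split; apply: eq_bigr => j _.
  by rewrite /h andb_addr signr_addb.
rewrite sum_tuple_prod /h /=; case: eqP => [->|/eqP xy].
  rewrite (eq_bigr (fun=> 2)) ?prodr_const ?card_ord // => j _.
  by rewrite addbb.
have [j nj] : exists j : 'I_D, bit x j != bit y j.
  apply/existsP; apply: contraR xy; rewrite negb_exists => /forallP e.
  apply/eqP/eq_bit => j jD; apply/eqP.
  by have := e (Ordinal jD); rewrite negbK.
by rewrite (bigD1 j) //= (_ : _ (+) _ = true) ?subrr ?mul0r //; case: bit nj; case: bit.
Qed.

Definition wsum S z : rat := \sum_(x in S) walsh z x.

(** By orthogonality only the pairs with [x = t y] survive, so the correlation counts the points of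
    [S] that [t] sends into [S]. *)
Lemma wsum_corr S (t : D.-tuple bool -> D.-tuple bool) :
  \sum_z wsum S z * (\sum_(y in S) walsh z (t y)) =
  2 ^+ D * (\sum_(y in S) (t y \in S))%:R.
Proof.
rewrite (eq_bigr (fun z => \sum_(x in S) \sum_(y in S) walsh z x * walsh z (t y))).
  rewrite exchange_big /= (eq_bigr (fun x => \sum_(y in S) if x == t y then 2 ^+ D else 0)).
    rewrite exchange_big /= natr_sum mulr_sumr; apply: eq_bigr => y _.
    have [tS|tS] := boolP (t y \in S).
      by rewrite (bigD1 (t y)) //= eqxx mulr1 big1 ?addr0 // => x /andP[_ /negPf->].
    by rewrite mulr0 big1 // => x xS; case: eqP => // e; rewrite -e xS in tS.
  by move=> x _; rewrite exchange_big; apply: eq_bigr => y _; apply: walsh_orth.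
by move=> z _; rewrite mulr_suml; apply: eq_bigr => x _; rewrite mulr_sumr.
Qed.

Definition zero_tuple : D.-tuple bool := [tuple of nseq D false].

Lemma bit_zero j : bit zero_tuple j = false.
Proof. by rewrite /bit /= nth_nseq if_same. Qed.

Lemma gdual0 g : gdual g zero_tuple = zero_tuple.
Proof. by apply: eq_bit => j _; rewrite bit_gdual !bit_zero !andbF. Qed.

Lemma wsum0 S : wsum S zero_tuple = #|S|%:R.
Proof.
rewrite /wsum (eq_bigr (fun=> 1)) ?sumr_const // => x _.
by rewrite /walsh big1 // => j _; rewrite bit_zero.
Qed.

Lemma wsum_parseval S : \sum_z wsum S z ^+ 2 = 2 ^+ D * #|S|%:R.
Proof.
transitivity (2 ^+ D * (\sum_(y in S) (y \in S))%:R : rat).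
  by rewrite -(wsum_corr S id); apply: eq_bigr => z _; rewrite expr2.
by rewrite (eq_bigr (fun=> 1%N)) ?sum1_card // => x ->.
Qed.

(* The indices below 3 are merged: there a translation already acts by -1, and
   a linear generator might shift the bit out of range. *)
Definition level z := maxn (find id z) 2.

Lemma level_le z j : bit z j -> (level z <= maxn j 2)%N.
Proof.
move=> zj; rewrite /level geq_max leq_maxr andbT leq_max leqNgt.
by case: ltnP => // /(before_find false); rewrite /= -/(bit z j) zj.
Qed.

(** Weights for a skewed AM-GM inequality: [lwt a b * lwt b a = 1], and passing to a lower level
    costs less than 1. *)
Definition lwt (a b : nat) : rat :=
  if (b < a)%N then 3 / 4 else if (a < b)%N then 4 / 3 else 1.

(** The coefficient of [wsum S z ^+ 2] in the bound for [g]: an AM-GM weight for a linear generator,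
    the exact eigenvalue for a translation. *)
Definition gwt g z : rat :=
  if g.1.1 then lwt (level z) (level (gdual g z)) else (-1) ^+ bit z (gcoord g).

Lemma lwt_amgm (a b : nat) (x y : rat) :
  x * y <= (lwt a b * x ^+ 2 + lwt b a * y ^+ 2) / 2.
Proof.
have h1 := sqr_ge0 (x - y); have h2 := sqr_ge0 (x - 4 / 3 * y).
have h3 := sqr_ge0 (4 / 3 * x - y).
by rewrite /lwt; case: (ltngtP a b) => _; nra.
Qed.

Lemma lwt_le a b : lwt a b <= 4 / 3.
Proof. by rewrite /lwt; case: (ltngtP a b) => _; lra. Qed.

Lemma lwt_lt a b : (b < a)%N -> lwt a b = 3 / 4.
Proof. by rewrite /lwt => ->. Qed.

Lemma lwt_le1 a b : (b <= a)%N -> lwt a b <= 1.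
Proof. by rewrite /lwt (ltnNge a) => -> /=; case: ifP => _; lra. Qed.

Lemma sum_gen (F : gen -> rat) :
  \sum_g F g = F (true, true, true) + F (true, true, false) +
    (F (true, false, true) + F (true, false, false)) +
    (F (false, true, true) + F (false, true, false) +
     (F (false, false, true) + F (false, false, false))).
Proof.
rewrite (eq_bigr (fun g : gen => F (g.1, g.2))); last by case.
rewrite -(pair_bigA _ (fun a c => F (a, c))) /=.
rewrite (eq_bigr (fun a : bool * bool => \sum_c F (a.1, a.2, c))); last by case.
rewrite -(pair_bigA _ (fun a b => \sum_c F (a, b, c))) /=.
by rewrite !big_bool.
Qed.

(** The bound is 8 - 1/6, and it is the 1/6 that gives expansion. The worst case has least nonzero
    index [a >= 3] and bit [a.+1] zero: 3/4 + 3/4 + 1 + 4/3 for the linear generators and 4 for the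
    translations. *)
Lemma sum_gwt z : z != zero_tuple -> \sum_g gwt g z <= 47 / 6.
Proof.
move=> nz.
have [a za aD] : exists2 a, find id z = a & bit z a.
  exists (find id z) => //; rewrite /bit; apply: (@nth_find _ false id).
  apply: contraR nz => /hasPn h; apply/eqP/eq_bit => j jD.
  rewrite bit_zero; apply/negbTE/h; rewrite mem_nth ?size_tuple //.
have lo j : (j < a)%N -> bit z j = false.
  by rewrite -za => /(before_find false).
have sgn j : (-1) ^+ bit z j <= 1 :> rat by case: bit; rewrite ?expr0 ?expr1 //; lra.
have wle (g : gen) : g.1.1 -> gwt g z <= 4 / 3 by rewrite /gwt => ->; apply: lwt_le.
have lev : level z = maxn a 2 by rewrite /level za.
rewrite sum_gen.
have F3 := sgn 3%N; have F2 := sgn 2%N; have F1 := sgn 1%N; have F0 := sgn 0%N.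
have flips : gwt (false, true, true) z + gwt (false, true, false) z +
     (gwt (false, false, true) z + gwt (false, false, false) z) =
    (-1) ^+ bit z 3 + (-1) ^+ bit z 2 + ((-1) ^+ bit z 1 + (-1) ^+ bit z 0) by [].
(* For [a < 3] the translation flipping coordinate [a] has eigenvalue -1, so the translations add up
   to at most 2 and the total is at most 4 * 4/3 + 2. *)
have [a3|a3] := ltnP a 3.
  have : gwt (false, true, true) z + gwt (false, true, false) z +
     (gwt (false, false, true) z + gwt (false, false, false) z) <= 2.
    have : (-1) ^+ bit z a = -1 :> rat by rewrite aD.
    by rewrite flips; case: a a3 {za aD lo lev} => [|[|[|]]] // _ e; lra.
  have := wle (true, true, true) isT; have := wle (true, true, false) isT.
  have := wle (true, false, true) isT; have := wle (true, false, false) isT.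
  lra.
have up (g : gen) j : g.1.1 -> bit (gdual g z) j -> (j < a)%N -> gwt g z = 3 / 4.
  move=> lin /level_le le ja; rewrite /gwt lin lwt_lt // lev.
  by apply: leq_ltn_trans le _; lia.
(* Both linear generators of the parity of [a] copy bit [a] down to an index that held 0. *)
have upa (g : gen) : g.1.1 -> g.1.2 = odd a -> gwt g z = 3 / 4.
  move=> lin ga; have sa : (gshift g <= a)%N by rewrite /gshift; case: g.2; lia.
  have s0 : (0 < gshift g)%N by rewrite /gshift; case: g.2.
  apply: (up _ (a - gshift g)%N lin); last by lia.
  by rewrite bit_gdual lin subnK // ga eqxx aD lo //; lia.
(* For the other parity: if bit [a.+1] is 0, the generator of shift 1 keeps bit [a]; if it is 1, the
   generator of shift 3 creates bit [a - 2]. *)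
have stay : bit z a.+1 = false -> gwt (true, ~~ odd a, false) z <= 1.
  move=> z1; apply: lwt_le1; rewrite lev; apply: level_le.
  by rewrite bit_gdual /= addn1 z1 andbF addbF.
have up3 : bit z a.+1 -> gwt (true, ~~ odd a, true) z = 3 / 4.
  move=> z1; apply: (up _ (a - 2)%N) => //; last by lia.
  rewrite bit_gdual /= lo; last by lia.
  rewrite (_ : (a - 2 + 3)%N = a.+1) ?z1 ?andbT /=; last by lia.
  by rewrite eqxx.
have w1 := wle (true, ~~ odd a, true) isT; have w2 := wle (true, ~~ odd a, false) isT.
have u1 := upa (true, odd a, true) isT erefl.
have u2 := upa (true, odd a, false) isT erefl.
have F : gwt (false, true, true) z + gwt (false, true, false) z +
     (gwt (false, false, true) z + gwt (false, false, false) z) <= 4.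
  by rewrite flips; lra.
have [z1|z1] := boolP (bit z a.+1).
  have u3 := up3 z1.
  by case: (odd a) w1 w2 u1 u2 u3 => /= w1 w2 u1 u2 u3; lra.
have u3 := stay (negbTE z1).
by case: (odd a) w1 w2 u1 u2 u3 => /= w1 w2 u1 u2 u3; lra.
Qed.

Definition gstay S : nat := \sum_(g : gen) \sum_(y in S) (gact_tuple g y \in S).

Lemma gstay_le S : (gstay S <= 8 * #|S|)%N.
Proof.
have -> : (8 * #|S| = \sum_(g : gen) #|S|)%N.
  by rewrite sum_nat_const !card_prod card_bool.
apply: leq_sum => g _; rewrite -sum1_card.
by apply: leq_sum => y _; case: (_ \in _).
Qed.

(** The zero character gives the square of the density term; each other product of coefficients at
    [z] and [gdual g z] is split by AM-GM. *)
Lemma gcorr g S :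
  2 ^+ D * (\sum_(y in S) (gact_tuple g y \in S))%:R <=
  #|S|%:R ^+ 2 + \sum_(z | z != zero_tuple) gwt g z * wsum S z ^+ 2.
Proof.
rewrite -wsum_corr (bigD1 zero_tuple) //= wsum0.
have -> : \sum_(y in S) walsh zero_tuple (gact_tuple g y) = #|S|%:R.
  rewrite (eq_bigr (fun=> 1)) ?sumr_const // => x _.
  by rewrite /walsh big1 // => j _; rewrite bit_zero.
rewrite -expr2 lerD2l.
under eq_bigr => z _ do (under [X in _ * X]eq_bigr do rewrite walsh_gact; rewrite -mulr_suml).
rewrite /gwt; case lin: g.1.1; last first.
  apply: ler_sum => z _; rewrite (_ : gdual g z = z).
    by rewrite mulrA -expr2 mulrC.
  by apply: eq_bit => j _; rewrite bit_gdual lin addbF.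
(* As [gdual g] is an involution fixing the zero character, the two halves of the AM-GM bound have
   equal sums. *)
pose L z := lwt (level z) (level (gdual g z)) * wsum S z ^+ 2.
apply: (@le_trans _ _ (\sum_(z | z != zero_tuple) (L z + L (gdual g z)) / 2)).
  apply: ler_sum => z _; rewrite mulr1 /L gdualK; exact: lwt_amgm.
rewrite -mulr_suml big_split /=.
have -> : \sum_(z | z != zero_tuple) L (gdual g z) = \sum_(z | z != zero_tuple) L z.
  rewrite [RHS](reindex_inj (inv_inj (gdualK g))); apply: eq_bigl => z.
  by rewrite -[X in _ = (_ != X)](gdual0 g) (inj_eq (inv_inj (gdualK g))).
rewrite -[leRHS]/(\sum_(z | z != zero_tuple) L z); lra.
Qed.

(** Summing [gcorr] over the generators and applying Parseval leaves the gap 8 - 47/6 = 1/6, whence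
    the factor 6. *)
Lemma expansion S :
  (#|S| * (2 ^ D - #|S|) <= 6 * 2 ^ D * (8 * #|S| - gstay S))%N.
Proof.
have N0 : 0 < 2 ^+ D :> rat by rewrite exprn_gt0.
have SN : (#|S| <= 2 ^ D)%N.
  by rewrite (leq_trans (max_card _)) // card_tuple card_bool.
have e : 2 ^+ D * (gstay S)%:R <=
    8 * #|S|%:R ^+ 2 + 47 / 6 * (2 ^+ D * #|S|%:R - #|S|%:R ^+ 2) :> rat.
  rewrite /gstay natr_sum mulr_sumr.
  apply: le_trans (ler_sum _ (fun g _ => gcorr g S)) _.
  rewrite big_split /= sumr_const !card_prod card_bool -[_ *+ _]mulr_natl lerD2l.
  have -> : 2 ^+ D * #|S|%:R - #|S|%:R ^+ 2 = \sum_(z | z != zero_tuple) wsum S z ^+ 2.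
    by rewrite -wsum_parseval (bigD1 zero_tuple) //= wsum0 addrAC subrr add0r.
  rewrite exchange_big /=.
  rewrite mulr_sumr; apply: ler_sum => z nz; rewrite -mulr_suml.
  by apply: ler_wpM2r; [apply: sqr_ge0 | apply: sum_gwt].
have st := gstay_le S.
rewrite -(ler_nat rat) !natrM !natrB // natrM natrX; nra.
Qed.

End Expansion.

(** * Flows on the expander *)

(** Token indices have 7 bits: three name a generator, and the other four provide 16 parallel copies
    of it. *)
Definition gen_of (i : seq bool) : gen := (nth false i 0, nth false i 1, nth false i 2).

Lemma sum_gen_of (F : gen -> nat) :
  \sum_(i : 7.-tuple bool) F (gen_of i) = 16 * \sum_(g : gen) F g.
Proof.
pose G (a b c : bool) := F (a, b, c).
have -> : \sum_(g : gen) F g = \sum_a \sum_b \sum_c G a b c.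
  rewrite pair_bigA pair_bigA /=.
  by apply: eq_bigr => -[[a b] c] _.
rewrite (big_tupleS _ _ (fun i => F (gen_of i))) big_distrr; apply: eq_bigr => a _ /=.
rewrite (big_tupleS _ _ (fun i => F (gen_of (a :: i)))) big_distrr; apply: eq_bigr => b _ /=.
rewrite (big_tupleS _ _ (fun i => F (gen_of [:: a, b & i]))) big_distrr; apply: eq_bigr => c _ /=.
rewrite -[LHS]/(\sum_(i : 4.-tuple bool) G a b c).
by rewrite sum_nat_const card_tuple card_bool.
Qed.

(** Inclusion-exclusion for each of the 8 generators, whose action is a bijection. *)
Lemma gtouch D (S : {set D.-tuple bool}) :
  \sum_(g : gen) \sum_y ((y \in S) || (gact_tuple g y \in S)) + gstay S = 16 * #|S|.
Proof.
rewrite /gstay -big_split /=.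
have -> : 16 * #|S| = \sum_(g : gen) 2 * #|S|.
  by rewrite sum_nat_const !card_prod card_bool; lia.
apply: eq_bigr => g _; rewrite [X in _ + X]big_mkcond -big_split /=.
have c1 : \sum_y (y \in S) = #|S|.
  by rewrite -sum1_card [RHS]big_mkcond; apply: eq_bigr => y _; case: (y \in S).
have c2 : \sum_y (gact_tuple g y \in S) = #|S|.
  by rewrite -[RHS]c1 [RHS](reindex_inj (inv_inj (gact_tupleK g))).
rewrite mul2n -addnn -{1}c1 -c2 -big_split /=.
by apply: eq_bigr => y _; case: (y \in S); case: (_ \in S).
Qed.

(** Hall's condition for a set of [n] of the [N] vertices. With [e = 8 * n - st] it reduces to
    [theta * n <= fS + 16 * (B * e)]. If the set is at most half of the graph, expansion gives
    [n <= 12 * e]. Otherwise it gives [N - n <= 12 * e], and the complement holds at most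
    [B * (N - n)] of the total [fA]. The 16 copies of each generator exceed the 12 needed. *)
Lemma flow_arith N n st X theta B fS fA d :
    0 < N -> n <= N -> X + st = 16 * n -> st <= 8 * n ->
    n * (N - n) <= 6 * N * (8 * n - st) -> theta <= B -> theta * N <= fA ->
    fA <= fS + B * (N - n) -> d + fS = n * (theta + 128 * B) ->
  d <= B * (16 * X).
Proof.
move=> N0 nN Xst st8 ex tB tN fA_le dE; set e := 8 * n - st in ex *.
have -> : X = 8 * n + e by rewrite /e; lia.
have key : theta * n <= fS + 16 * (B * e).
  have [h|h] := leqP (2 * n) N.
    have : N * n <= N * (12 * e) by nia.
    by rewrite leq_pmul2l // => h'; nia.
  have : N * (N - n) <= N * (12 * e) by nia.
  rewrite leq_pmul2l // => h'.
  have : theta * n <= theta * N by rewrite leq_mul2l nN orbT.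
  nia.
lia.
Qed.

Lemma balance_arith theta B f kept given got :
    f <= B -> kept + given = 128 * B -> theta + 128 * B - f <= kept + got ->
  theta + given <= f + got.
Proof. by lia. Qed.

Lemma expander_flow D b theta (f : D.-tuple bool -> nat) :
    (forall v, f v <= 2 ^ b) -> theta <= 2 ^ b -> theta * 2 ^ D <= \sum_v f v ->
  exists beta : 7.-tuple bool -> b.-tuple bool -> D.-tuple bool -> bool,
    forall v, theta + \sum_i \sum_u beta i u v <=
      f v + \sum_i \sum_u beta i u (gact_tuple (gen_of i) v).
Proof.
move=> fb tb tf.
pose T := (7.-tuple bool * b.-tuple bool * D.-tuple bool)%type.
(* Every vertex owns [128 * 2 ^ b] tokens, so its outflow is this number minus the tokens kept.
   Balance thus asks that tokens kept and tokens received together reach [dem v]. *)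
pose dem v := theta + 128 * 2 ^ b - f v.
pose tgt (t : T) := gact_tuple (gen_of t.1.1) t.2.
have sumT (F : 7.-tuple bool -> b.-tuple bool -> D.-tuple bool -> nat) :
    \sum_(t : T) F t.1.1 t.1.2 t.2 = \sum_i \sum_u \sum_y F i u y.
  by rewrite pair_bigA pair_bigA.
have [|o ho] := @orientation _ T dem (fun t => t.2) tgt.
  move=> S.
  rewrite (sumT (fun i u y => (y \in S) || (gact_tuple (gen_of i) y \in S) : nat)).
  rewrite (eq_bigr (fun i : 7.-tuple bool => 2 ^ b *
      \sum_y ((y \in S) || (gact_tuple (gen_of i) y \in S)))); last first.
    by move=> i _; rewrite sum_nat_const card_tuple card_bool.
  rewrite -big_distrr /=.
  rewrite (sum_gen_of (fun g => \sum_y ((y \in S) || (gact_tuple g y \in S)))).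
  have dsum : \sum_(v in S) dem v + \sum_(v in S) f v = #|S| * (theta + 128 * 2 ^ b).
    rewrite -big_split -sum_nat_const; apply: eq_bigr => v _ /=.
    by rewrite /dem subnK //; have := fb v; lia.
  have fS : \sum_v f v <= \sum_(v in S) f v + 2 ^ b * (2 ^ D - #|S|).
    rewrite (bigID (mem S)) /= leq_add2l mulnC.
    have <- : #|[predC S]| = 2 ^ D - #|S|.
      have <- : #|{: D.-tuple bool}| = 2 ^ D by rewrite card_tuple card_bool.
      by rewrite -(cardC S) addKn.
    by rewrite -sum_nat_const; apply: leq_sum => v _; apply: fb.
  have SD : #|S| <= 2 ^ D.
    by rewrite (leq_trans (max_card _)) // card_tuple card_bool.
  exact: (flow_arith (expn_gt0 2 D) SD (gtouch S) (gstay_le S) (expansion S) tb tf fS dsum).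
exists (fun i u v => o (i, u, v)) => v.
have := ho v.
(* A token ending at [v] is either kept by [v] or sent by [gact_tuple (gen_of i) v], since each
   generator is an involution. *)
rewrite (eq_bigr (fun t : T => (~~ o (t.1.1, t.1.2, t.2) && (t.2 == v)) +
    (o (t.1.1, t.1.2, t.2) && (t.2 == gact_tuple (gen_of t.1.1) v)) : nat)); last first.
  move=> [[i u] y] _ /=; case: (o _) => //=; rewrite /tgt /= ?addn0 //.
  by congr (nat_of_bool _); apply/eqP/eqP => [<-|->]; rewrite gact_tupleK.
rewrite (sumT (fun i u y => (~~ o (i, u, y) && (y == v)) +
    (o (i, u, y) && (y == gact_tuple (gen_of i) v)))).
have pick (P : pred (D.-tuple bool)) y0 : \sum_y (P y && (y == y0)) = P y0 :> nat.
  rewrite (bigD1 y0) //= eqxx andbT big1 ?addn0 // => y /negPf->.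
  by rewrite andbF.
under eq_bigr => i _ do under eq_bigr => u _ do
  rewrite big_split /= (pick (fun y => ~~ o (i, u, y))) (pick (fun y => o (i, u, y))).
have split2 (A B : 7.-tuple bool -> b.-tuple bool -> nat) :
    \sum_i \sum_u (A i u + B i u) = \sum_i \sum_u A i u + \sum_i \sum_u B i u.
  by rewrite -big_split; apply: eq_bigr => i _; rewrite big_split.
rewrite split2.
have : \sum_i \sum_u ~~ o (i, u, v) + \sum_i \sum_u o (i, u, v) = 128 * 2 ^ b.
  rewrite -split2 (eq_bigr (fun=> 2 ^ b)).
    by rewrite sum_nat_const card_tuple card_bool.
  move=> i _; rewrite (eq_bigr (fun=> 1)) ?sum1_card ?card_tuple ?card_bool // => u _.
  by case: (o _).
move=> own le; apply: (balance_arith (fb v) own le).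
Qed.

(** * Turing machines *)

Definition act (a : cell * move) (t : tape) : tape := shift a.2 (write a.1 t).

Lemma act_stay t : act (tcur t, Stay) t = t.
Proof. by case: t. Qed.

(** The index is an upper bound on the number of steps, as [reach_refl] holds for every [n]. *)
Inductive reach (M : TM) : nat -> config M -> config M -> Prop :=
| reach_refl n k : reach n k k
| reach_step n k k1 k2 : step k = Some k1 -> reach n k1 k2 -> reach n.+1 k k2.

Lemma reach_trans M m n (k k1 k2 : config M) :
  reach m k k1 -> reach n k1 k2 -> reach (m + n) k k2.
Proof.
elim=> {m k k1} [m k|m k k' k1 e _ IH] r.
  by elim: r m => {n k k2} [n k|n k k1 k2 e _ IH] m;
    [left | rewrite addnS; right with k1].
by rewrite addSn; right with k'; last exact: IH.
Qed.

Lemma reach1 M (k k1 : config M) : step k = Some k1 -> reach 1 k k1.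
Proof. by move=> e; right with k1; last by left. Qed.

Lemma reach_leq M m n (k k1 : config M) : m <= n -> reach m k k1 -> reach n k k1.
Proof.
by move=> le r; rewrite -(subnKC le); apply: reach_trans r (reach_refl _ _).
Qed.

Lemma reach_run M n t (k k1 : config M) :
  reach n k k1 -> step k1 = None -> n <= t -> run t k = k1.
Proof.
move=> r h; elim: r h t => {n k k1} [n k|n k k' k1 e _ IH] h [|t] //=; rewrite ?h ?e //.
by move=> le; apply: IH.
Qed.

Lemma run_halted M n t (k : config M) :
  step (run n k) = None -> n <= t -> run t k = run n k.
Proof.
elim: n t k => [|n IH] [|t] k //=; first by move=> ->.
by case e: (step k) => [k1|//]; apply: IH.
Qed.

Lemma computes_withinW M w v n t :
  n <= t -> computes_within M w v n -> computes_within M w v t.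
Proof. by move=> le [h1 h2]; rewrite /computes_within (run_halted h1 le). Qed.

Lemma leq_poly C d m n : m <= n -> C * m ^ d + C <= C * n ^ d + C.
Proof.
move=> le; rewrite leq_add2r leq_mul2l; apply/orP; right.
by case: d => // d; rewrite leq_exp2r.
Qed.

(** Equality of tapes as infinite words: the lists may differ in the explicit blanks at their
    ends. *)
Definition teq (t t' : tape) : Prop :=
  [/\ tcur t = tcur t', forall i, nth None (tleft t) i = nth None (tleft t') i
    & forall i, nth None (tright t) i = nth None (tright t') i].

Lemma teq_act a t t' : teq t t' -> teq (act a t) (act a t').
Proof.
case: a => c m; case: t => l x r; case: t' => l' x' r' [/= _ hl hr].
case: m; split=> //=; try by rewrite -!nth0.
- by move=> i; rewrite !nth_behead.
- by case.
- by case.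
- by move=> i; rewrite !nth_behead.
Qed.

Lemma nonblank_prefix_ext s s' :
  (forall i, nth None s i = nth None s' i) -> nonblank_prefix s = nonblank_prefix s'.
Proof.
elim: s s' => [|a s IH] [|a' s'] //= h; first by have /= <- := h 0.
  by have /= -> := h 0.
have /= <- := h 0; case: a h => //= x h.
by rewrite (IH s') // => i; apply: (h i.+1).
Qed.

Lemma size_nonblank_prefix s : size (nonblank_prefix s) <= size s.
Proof. by elim: s => //= -[]. Qed.

Lemma step_size_tright M (k k1 : config M) j : step k = Some k1 ->
  size (tright (ctapes k1 j)) <= (size (tright (ctapes k j))).+1.
Proof.
rewrite /step; case: delta => [[q a]|//] [<-] /=; rewrite ffunE.
case: (a j) => c [] /=; rewrite ?size_behead //; lia.
Qed.

Lemma run_size_tright M n (k : config M) j :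
  size (tright (ctapes (run n k) j)) <= size (tright (ctapes k j)) + n.
Proof.
elim: n k => [|n IH] k /=; first by rewrite addn0.
case e: (step k) => [k1|]; last by rewrite leq_addr.
by apply: leq_trans (IH k1) _; have := step_size_tright j e; lia.
Qed.

(** Each step lengthens the listed part of a tape by at most one cell. This bounds the list of
    queries that a called machine returns. *)
Lemma size_output M w v n : computes_within M w v n -> size v <= size w + n + 1.
Proof.
case=> _ <-; rewrite /output; apply: leq_trans (size_nonblank_prefix _) _ => /=.
have := run_size_tright n (init M w) ord0.
by rewrite ffunE eqxx /= size_behead size_map; lia.
Qed.

(** * Polynomial time bounds *)

Definition pbound (f : nat -> nat) : Prop :=
  exists C d, forall n, f n <= C * n ^ d + C.

Lemma pbound_const c : pbound (fun=> c).
Proof. by exists c, 0 => n; rewrite leq_addl. Qed.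

Lemma pbound_id : pbound id.
Proof. by exists 1, 1 => n; rewrite mul1n expn1 leq_addr. Qed.

Lemma pbound_poly C d : pbound (fun n => C * n ^ d + C).
Proof. by exists C, d. Qed.

(** The summand 1 covers [0 ^ 0 = 1]. *)
Lemma pow_leq_add n d e : n ^ d <= n ^ (d + e) + 1.
Proof.
case: n => [|n]; first by case: d => [|d]; [apply: leq_addl | rewrite exp0n].
by rewrite (leq_trans _ (leq_addr _ _)) // leq_pexp2l // leq_addr.
Qed.

Lemma pboundD f g : pbound f -> pbound g -> pbound (fun n => f n + g n).
Proof.
move=> [C [d hf]] [C' [d' hg]]; exists (2 * (C + C')), (d + d') => n.
have := hf n; have := hg n; have := pow_leq_add n d d'; have := pow_leq_add n d' d.
by rewrite (addnC d'); nia.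
Qed.

Lemma pboundM f g : pbound f -> pbound g -> pbound (fun n => f n * g n).
Proof.
move=> [C [d hf]] [C' [d' hg]]; exists (3 * (C * C')), (d + d') => n.
have h1 := pow_leq_add n d d'; have := pow_leq_add n d' d; rewrite (addnC d') => h2.
apply: leq_trans (leq_mul (hf n) (hg n)) _.
have -> : (C * n ^ d + C) * (C' * n ^ d' + C') =
    C * C' * (n ^ (d + d') + n ^ d + n ^ d' + 1) by rewrite expnD; nia.
move: (C * C') (n ^ (d + d')) (n ^ d) (n ^ d') h1 h2 => X a b c h1 h2.
apply: (@leq_trans (X * (3 * (a + 1)))); last by lia.
by rewrite leq_mul2l; apply/orP; right; lia.
Qed.

Lemma poly_timeP (A B : Type) (inp : A -> seq (seq bool)) (out : B -> seq (seq bool))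
    (f : A -> B) (M : TM) (T : nat -> nat) :
    pbound T ->
    (forall a, exists k, [/\ reach (T (size (encode (inp a)))) (init M (encode (inp a))) k,
       step k = None & output k = encode (out (f a))]) ->
  poly_time inp out f.
Proof.
move=> [C [d hT]] h; exists M, C, d => a; have [k [r hk ko]] := h a.
by rewrite /computes_within (reach_run r hk (hT _)).
Qed.

(* The tape with [l] from the head on, followed by [r]; when the first cell of
   [r] is blank or missing, [l] is the word read from the head. *)
Definition zip_tape (g : seq cell) (l : seq symbol) (r : seq cell) : tape :=
  Tape g (head None (map Some l ++ r)) (behead (map Some l ++ r)).

(** * A machine that calls another machine *)

Section Wrapper.
Variables (M : TM) (P : finType) (p0 : P).
Variable d : P -> cell -> cell -> cell ->
  option (bool * P * (cell * move) * (cell * move) * (cell * move)).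

Local Notation n := (extra_tapes M).

Definition glue X (o w : X) (ts : 'I_n.+1 -> X) (i : 'I_n.+3) : X :=
  oapp (fun i' => oapp ts w (unlift ord0 i')) o (unlift ord0 i).

Definition tapeW : 'I_n.+3 := lift ord0 ord0.
Definition tapeM (j : 'I_n.+1) : 'I_n.+3 := lift ord0 (lift ord0 j).

Lemma glueO X o w ts : @glue X o w ts ord0 = o.
Proof. by rewrite /glue unlift_none. Qed.

Lemma glueW X o w ts : @glue X o w ts tapeW = w.
Proof. by rewrite /glue /tapeW liftK /= unlift_none. Qed.

Lemma glueM X o w ts j : @glue X o w ts (tapeM j) = ts j.
Proof. by rewrite /glue /tapeM liftK /= liftK. Qed.

Lemma glueP (Q : 'I_n.+3 -> Prop) :
  Q ord0 -> Q tapeW -> (forall j, Q (tapeM j)) -> forall i, Q i.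
Proof.
move=> h0 h1 h2 i; case: (unliftP ord0 i) => [i' ->|->//].
by case: (unliftP ord0 i') => [j ->|->]; [apply: h2 | apply: h1].
Qed.

(* Tape 0 is the input and output tape, tape 1 a work tape, and the others are
   those of [M]. In state [inr p] the control [d] acts on tapes 0 and 1 and on
   the first tape of [M], and may start [M]; in state [inl (q, p)] the machine
   [M] is run, and control passes to [p] when it halts. *)
Definition wrapper_delta (q : state M * P + P) (a : {ffun 'I_n.+3 -> cell}) :
    option ((state M * P + P) * {ffun 'I_n.+3 -> cell * move}) :=
  match q with
  | inl (qm, p) =>
      if delta qm [ffun j => a (tapeM j)] is Some (qm', m) then
        Some (inl (qm', p), [ffun i => glue (a ord0, Stay) (a tapeW, Stay) m i])
      else Some (inr p, [ffun i => (a i, Stay)])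
  | inr p =>
      if d p (a ord0) (a tapeW) (a (tapeM ord0)) is Some (e, p', ao, aw, at') then
        Some (if e then inl (start M, p') else inr p',
          [ffun i => glue ao aw
             (fun j => if j == ord0 then at' else (a (tapeM j), Stay)) i])
      else None
  end.

Definition wrapper : TM :=
  @MkTM n.+2 (state M * P + P)%type (inr p0) wrapper_delta.

Definition wconf (q : state wrapper) o w (ts : {ffun 'I_n.+1 -> tape}) : config wrapper :=
  @Config wrapper q [ffun i => glue o w ts i].

Lemma wconf_eq (q : state wrapper) (ts : {ffun 'I_n.+3 -> tape}) o w
    (ts' : {ffun 'I_n.+1 -> tape}) :
  ts ord0 = o -> ts tapeW = w -> (forall j, ts (tapeM j) = ts' j) ->
  @Config wrapper q ts = wconf q o w ts'.
Proof.
move=> ho hw hm; congr Config; apply/ffunP; apply: glueP => [||j]; rewrite ffunE.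
- by rewrite glueO.
- by rewrite glueW.
- by rewrite glueM.
Qed.

Lemma step_sim qm p o w ts qm' ts' :
  step (@Config M qm ts) = Some (@Config M qm' ts') ->
  step (wconf (inl (qm, p)) o w ts) = Some (wconf (inl (qm', p)) o w ts').
Proof.
rewrite /step /= /wrapper_delta.
have -> : [ffun j => [ffun i => tcur ([ffun i0 => glue o w ts i0] i)] (tapeM j)] =
          [ffun j => tcur (ts j)].
  by apply/ffunP => j; rewrite !ffunE glueM.
case: delta => [[q m]|//] [<- <-]; congr Some; apply: wconf_eq.
- by rewrite !ffunE !glueO; apply: act_stay.
- by rewrite !ffunE !glueW; apply: act_stay.
- by move=> j; rewrite !ffunE !glueM.
Qed.

Lemma step_sim_halt qm p o w ts : step (@Config M qm ts) = None ->
  step (wconf (inl (qm, p)) o w ts) = Some (wconf (inr p) o w ts).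
Proof.
rewrite /step /= /wrapper_delta.
have -> : [ffun j => [ffun i => tcur ([ffun i0 => glue o w ts i0] i)] (tapeM j)] =
          [ffun j => tcur (ts j)].
  by apply/ffunP => j; rewrite !ffunE glueM.
case: delta => [[q m]|] // _; congr Some; apply: wconf_eq.
- by rewrite !ffunE !glueO; apply: act_stay.
- by rewrite !ffunE !glueW; apply: act_stay.
- by move=> j; rewrite !ffunE !glueM; apply: act_stay.
Qed.

Definition set_tape0 (ts : {ffun 'I_n.+1 -> tape}) (t : tape) : {ffun 'I_n.+1 -> tape} :=
  [ffun j => if j == ord0 then t else ts j].

Definition ctl (ts : {ffun 'I_n.+1 -> tape}) (p : P) o w t : config wrapper :=
  wconf (inr p) o w (set_tape0 ts t).

Lemma ctl_tape0 ts p o w : wconf (inr p) o w ts = ctl ts p o w (ts ord0).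
Proof.
congr wconf; apply/ffunP => j; rewrite ffunE.
by case: eqP => [->|].
Qed.

Lemma step_ctl_gen ts p o w t e p' ao aw at' :
  d p (tcur o) (tcur w) (tcur t) = Some (e, p', ao, aw, at') ->
  step (ctl ts p o w t) =
  Some (wconf (if e then inl (start M, p') else inr p')
         (act ao o) (act aw w) (set_tape0 ts (act at' t))).
Proof.
move=> h; rewrite /step /= /wrapper_delta !ffunE glueO glueW glueM ffunE eqxx h.
congr Some; apply: wconf_eq.
- by rewrite !ffunE !glueO.
- by rewrite !ffunE !glueW.
- move=> j; rewrite !ffunE !glueM; case: eqP => [->|/eqP/negPf nj].
    by rewrite !ffunE.
  by rewrite !ffunE glueM ffunE nj; apply: act_stay.
Qed.

Lemma step_ctl ts p o w t p' ao aw at' o' w' t' :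
  d p (tcur o) (tcur w) (tcur t) = Some (false, p', ao, aw, at') ->
  act ao o = o' -> act aw w = w' -> act at' t = t' ->
  step (ctl ts p o w t) = Some (ctl ts p' o' w' t').
Proof. by move=> h <- <- <-; apply: step_ctl_gen h. Qed.

Lemma step_ctl_halt ts p o w t : d p (tcur o) (tcur w) (tcur t) = None ->
  step (ctl ts p o w t) = None.
Proof.
by move=> h; rewrite /step /= /wrapper_delta !ffunE glueO glueW glueM ffunE eqxx h.
Qed.

Lemma output_ctl ts p o w t :
  output (ctl ts p o w t) = nonblank_prefix (tcur o :: tright o).
Proof. by rewrite /output /= ffunE glueO. Qed.

(** Steps depend on tapes only up to [teq], so the simulation may start from tapes with extra
    explicit blanks; the additional step hands control back. *)
Lemma reach_sim m (k : config M) p o w (ts : {ffun 'I_n.+1 -> tape}) :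
    step (run m k) = None -> (forall j, teq (ts j) (ctapes k j)) ->
  exists2 ts', reach m.+1 (wconf (inl (cstate k, p)) o w ts) (wconf (inr p) o w ts')
    & forall j, teq (ts' j) (ctapes (run m k) j).
Proof.
have halt (k' : config M) (ts1 : {ffun 'I_n.+1 -> tape}) : step k' = None -> (forall j, teq (ts1 j) (ctapes k' j)) ->
    step (@Config M (cstate k') ts1) = None.
  rewrite /step /= => h e; rewrite (_ : [ffun i => _] = [ffun i => tcur (ctapes k' i)]).
    by move: h; case: delta => [[]|].
  by apply/ffunP => j; rewrite !ffunE; case: (e j).
elim: m k ts => [|m IH] k ts /= h e.
  exists ts => //; right with (wconf (inr p) o w ts); last by left.
  exact/step_sim_halt/halt.
case ek: (step k) h => [k1|] h; last first.
  exists ts => //; right with (wconf (inr p) o w ts); last by left.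
  exact/step_sim_halt/halt.
have [ts1 s1 e1] : exists2 ts1, step (@Config M (cstate k) ts) = Some (Config (cstate k1) ts1)
    & forall j, teq (ts1 j) (ctapes k1 j).
  move: ek; rewrite /step /=.
  rewrite (_ : [ffun i => tcur (ts i)] = [ffun i => tcur (ctapes k i)]); last first.
    by apply/ffunP => j; rewrite !ffunE; case: (e j).
  case: delta => [[q m']|//] [<-] /=; eexists; first by [].
  by move=> j; rewrite !ffunE; apply: teq_act.
have [ts' r e'] := IH k1 ts1 h e1.
by exists ts' => //; right with (wconf (inl (cstate k1, p)) o w ts1); first exact: step_sim.
Qed.

Definition blank_tapes : {ffun 'I_n.+1 -> tape} := [ffun=> blank_tape].

Lemma init_wrapper v : init wrapper v = ctl blank_tapes p0 (input_tape v) blank_tape blank_tape.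
Proof.
rewrite /init /ctl; apply: wconf_eq => [||j]; rewrite !ffunE //.
by rewrite if_same.
Qed.

Lemma reach_call v out m p o w g r :
    computes_within M v out m ->
    (forall i, nth None g i = None) -> (forall i, nth None r i = None) ->
  exists2 ts, reach m.+1
      (wconf (inl (start M, p)) o w (set_tape0 blank_tapes (zip_tape g v r)))
      (ctl ts p o w (ts ord0))
    & nonblank_prefix (tcur (ts ord0) :: tright (ts ord0)) = out.
Proof.
case=> h ho hg hr.
have [|ts r1 e1] := reach_sim p o w (ts := set_tape0 blank_tapes (zip_tape g v r)) h.
  move=> j; rewrite !ffunE; case: eqP => _ //.
  have e i : nth None (map Some v ++ r) i = nth None (map Some v) i.
    rewrite nth_cat; case: ltnP => // le; rewrite hr nth_default //.
  split=> /= [|i|i]; rewrite -?nth0 ?nth_behead ?e // hg nth_nil //.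
exists ts; first by rewrite -ctl_tape0.
rewrite -ho /output; case: (e1 ord0) => -> _ hr1.
by apply: nonblank_prefix_ext => -[].
Qed.
End Wrapper.

(** [K] is a configuration as a function of the tape to be rewound, so the lemma serves any tape and
    any control state; the blank left of [u] stops the head. *)
Lemma rewind M (K K' : tape -> config M) :
    (forall t, tcur t != None -> step (K t) = Some (K (act (tcur t, MoveLeft) t))) ->
    (forall t, tcur t = None -> step (K t) = Some (K' (act (None, MoveRight) t))) ->
  forall g u l r, head None g = None ->
    let t := zip_tape (catrev (map Some u) g) l (None :: r) in
    reach (size u).+1 (K (act (tcur t, MoveLeft) t))
      (K' (zip_tape (None :: behead g) (u ++ l) (None :: r))).
Proof.
move=> hl hr g u l r g0; elim/last_ind: u l => [|u s IH] l /=.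
  right with (K' (zip_tape (None :: behead g) l (None :: r))); last by left.
  rewrite hr /=; first by case: l.
  by rewrite g0.
rewrite size_rcons cat_rcons; have := IH (s :: l).
rewrite map_rcons -cats1 catrev_catl /=.
set t := zip_tape _ (s :: l) _ => IHt.
right with (K (act (tcur t, MoveLeft) t)) => //.
rewrite (_ : act _ _ = t); first by rewrite hl.
by case: l {IH IHt} @t.
Qed.

(** * The machine for the decision *)

Variant dtag := DInput | DCoins | DAnswers | DPop | DSep | DTurn | DRewind
  | DVerdict | DEnd | DHalt.

Definition dtag_code (t : dtag) : 'I_10 :=
  match t with
  | DInput => inord 0 | DCoins => inord 1 | DAnswers => inord 2 | DPop => inord 3
  | DSep => inord 4 | DTurn => inord 5 | DRewind => inord 6 | DVerdict => inord 7
  | DEnd => inord 8 | DHalt => inord 9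
  end.

Definition dtag_decode (i : 'I_10) : dtag :=
  nth DHalt [:: DInput; DCoins; DAnswers; DPop; DSep; DTurn; DRewind; DVerdict; DEnd; DHalt] i.

Lemma dtag_codeK : cancel dtag_code dtag_decode.
Proof. by case; rewrite /dtag_decode /= inordK. Qed.

HB.instance Definition _ := Finite.copy dtag (can_type dtag_codeK).

Ltac ctl_step := eapply step_ctl; [reflexivity | try by rewrite ?act_stay ..].

Section Decide.
Variables (dc : seq bool -> seq bool -> seq bool -> bool) (b Qm : nat).
Variables (pop : nat -> nat) (comb : nat -> seq bool -> bool -> bool).
Hypothesis pop_le : forall m, pop m <= Qm.

(** The extra answers stand last in [a]. The length of [w] is capped at [b] so that a finite control
    can remember it together with these answers. *)
Definition pop_decide (x w a : seq bool) : bool :=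
  let m := minn (size w) b in
  let n := size a - pop m in comb m (drop n a) (dc x w (take n a)).

Definition dstate := (dtag * 'I_b.+1 * Qm.-bseq bool)%type.

(* Copies x # w # a to the first tape of the machine for [dc], then moves the
   last [pop m] bits of a from there into the state. *)
Definition dctl (p : dstate) (o w t : cell) :
    option (bool * dstate * (cell * move) * (cell * move) * (cell * move)) :=
  let: (tag, m, acc) := p in
  match tag with
  | DInput =>
      match o with
      | Some (Some _) => Some (false, (DInput, m, acc), (None, MoveRight), (w, Stay), (o, MoveRight))
      | Some None => Some (false, (DCoins, m, acc), (None, MoveRight), (w, Stay), (o, MoveRight))
      | None => None
      end
  | DCoins =>
      match o with
      | Some (Some _) =>
          Some (false, (DCoins, inord (minn m.+1 b), acc), (None, MoveRight), (w, Stay), (o, MoveRight))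
      | Some None => Some (false, (DAnswers, m, acc), (None, MoveRight), (w, Stay), (o, MoveRight))
      | None => None
      end
  | DAnswers =>
      match o with
      | Some (Some _) => Some (false, (DAnswers, m, acc), (None, MoveRight), (w, Stay), (o, MoveRight))
      | Some None => Some (false, (DPop, m, acc), (None, MoveRight), (w, Stay), (t, MoveLeft))
      | None => None
      end
  | DPop =>
      match t with
      | Some (Some c) =>
          if size acc < pop m then
            Some (false, (DPop, m, insub_bseq Qm (c :: acc)), (o, Stay), (w, Stay), (None, MoveLeft))
          else Some (false, (DSep, m, acc), (o, Stay), (w, Stay), (t, MoveRight))
      | _ => Some (false, (DSep, m, acc), (o, Stay), (w, Stay), (t, MoveRight))
      end
  | DSep => Some (false, (DTurn, m, acc), (o, Stay), (w, Stay), (Some None, MoveRight))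
  | DTurn => Some (false, (DRewind, m, acc), (o, Stay), (w, Stay), (t, MoveLeft))
  | DRewind =>
      if t is None then Some (true, (DVerdict, m, acc), (o, Stay), (w, Stay), (None, MoveRight))
      else Some (false, (DRewind, m, acc), (o, Stay), (w, Stay), (t, MoveLeft))
  | DVerdict =>
      if t is Some (Some c) then
        Some (false, (DEnd, m, acc), (Some (Some (comb m acc c)), MoveRight), (w, Stay), (t, Stay))
      else None
  | DEnd => Some (false, (DHalt, m, acc), (Some None, MoveLeft), (w, Stay), (t, Stay))
  | DHalt => None
  end.

Variable M : TM.
Local Notation W := (wrapper M ((DInput, ord0, [bseq]) : dstate) dctl).
Local Notation K ts tag m acc := (@ctl M dstate (DInput, ord0, [bseq]) dctl ts (tag, m, acc)).
Local Notation written u := (zip_tape (catrev (map Some u) [::]) [::] [::]).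

Lemma written_rcons u c : act (Some c, MoveRight) (written u) = written (rcons u c).
Proof. by rewrite map_rcons -cats1 catrev_catl. Qed.

Lemma reach_copy tag m acc ts n x u l :
    (forall c o w t, o = Some (Some c) -> dctl (tag, m, acc) o w t =
       Some (false, (tag, m, acc), (None, MoveRight), (w, Stay), (o, MoveRight))) ->
  reach (size x)
    (K ts tag m acc (zip_tape (nseq n None) (map Some x ++ l) [::]) blank_tape (written u))
    (K ts tag m acc (zip_tape (nseq (n + size x) None) l [::]) blank_tape (written (u ++ map Some x))).
Proof.
move=> h; elim: x n u => [|c x IH] n u /=; first by rewrite addn0 cats0; left.
right with (K ts tag m acc (zip_tape (nseq n.+1 None) (map Some x ++ l) [::])
              blank_tape (written (rcons u (Some c)))).
  by eapply step_ctl; [apply: (h c) | | | exact: written_rcons].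
by rewrite -addSnnS -cat_rcons; apply: IH.
Qed.

Lemma reach_coins ts n x u l m acc :
  reach (size x)
    (K ts DCoins m acc (zip_tape (nseq n None) (map Some x ++ l) [::]) blank_tape (written u))
    (K ts DCoins (inord (minn (m + size x) b)) acc (zip_tape (nseq (n + size x) None) l [::])
      blank_tape (written (u ++ map Some x))).
Proof.
elim: x n u m => [|c x IH] n u m /=.
  rewrite !addn0 cats0 (minn_idPl _); last by rewrite -ltnS.
  by rewrite inord_val; left.
right with (K ts DCoins (inord (minn m.+1 b)) acc (zip_tape (nseq n.+1 None) (map Some x ++ l) [::])
              blank_tape (written (rcons u (Some c)))).
  by ctl_step; exact: written_rcons.
have := IH n.+1 (rcons u (Some c)) (inord (minn m.+1 b)).
rewrite inordK; last by rewrite ltnS geq_minr.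
rewrite addSnnS cat_rcons (_ : minn (minn m.+1 b + size x) b = minn (m + (size x).+1) b) //.
lia.
Qed.

(** Here [j] counts the explicit blanks right of the head that erased answers have left behind. *)
Definition popped (u : seq symbol) j : tape :=
  zip_tape (catrev (map Some u) [::]) [::] (nseq j.+1 None).

Lemma reach_pop ts o w pre (m : 'I_b.+1) a j (acc : Qm.-bseq bool) : size acc <= pop m ->
  exists (acc' : Qm.-bseq bool) j',
    let n := size a - (pop m - size acc) in
    acc' = drop n a ++ acc :> seq bool /\
    reach (size a).+1
      (K ts DPop m acc o w (act (None, MoveLeft) (popped (rcons pre None ++ map Some a) j)))
      (K ts DSep m acc' o w (popped (rcons pre None ++ map Some (take n a)) j')).
Proof.
(* Popping ends at the separator, or at a bit when enough bits have been taken. *)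
have stop a' s j0 (acc0 : Qm.-bseq bool) : (forall c, s = Some c -> pop m <= size acc0) ->
    reach 1
      (K ts DPop m acc0 o w (act (None, MoveLeft) (popped (rcons a' s) j0)))
      (K ts DSep m acc0 o w (popped (rcons a' s) j0)).
  move=> h; right with (K ts DSep m acc0 o w (popped (rcons a' s) j0)); last by left.
  have e : act (None, MoveLeft) (popped (rcons a' s) j0) =
      Tape (catrev (map Some a') [::]) (Some s) (nseq j0.+1 None).
    by rewrite /popped map_rcons -cats1 catrev_catl.
  have e' : popped (rcons a' s) j0 =
     act (Some s, MoveRight) (Tape (catrev (map Some a') [::]) (Some s) (nseq j0.+1 None)).
    by rewrite /popped map_rcons -cats1 catrev_catl.
  rewrite e e'; case: s h {e e'} => [c|] h; last by ctl_step.
  by eapply step_ctl; [rewrite /= ltnNge (h c)// | rewrite act_stay | rewrite act_stay | ].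
elim/last_ind: a j acc => [|a c IH] j acc acc_le.
  exists acc, j; split=> //; rewrite /= cats0.
  by apply: (reach_leq (m := 1)) => //; apply: stop.
have [lt|ge] := ltnP (size acc) (pop m); last first.
  exists acc, j => /=; rewrite (eqP ge) subn0 drop_size take_size; split=> //.
  rewrite map_rcons -rcons_cat; apply: reach_leq (stop _ _ _ _ _) => //.
(* There is still room in the bounded sequence, by [pop_le], so [insub_bseq] does not fall back on
   its default. *)
have cacc : insub_bseq Qm (c :: acc) = c :: acc :> seq bool.
  by rewrite /insub_bseq val_insubd /= (leq_trans lt (pop_le m)).
have [|acc' [j' [eacc r]]] := IH j.+1 (insub_bseq Qm (c :: acc)); first by rewrite cacc.
rewrite cacc /= in eacc r.
exists acc', j' => /=; rewrite size_rcons.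
have -> : (size a).+1 - (pop m - size acc) = size a - (pop m - (size acc).+1) by lia.
rewrite -cats1 drop_cat take_cat.
have nle : size a - (pop m - (size acc).+1) <= size a by rewrite leq_subr.
move: eacc r nle; set n := size a - _ => eacc r nle.
have -> : (if n < size a then drop n a ++ [:: c] else drop (n - size a) [:: c]) =
    rcons (drop n a) c.
  case: ltnP => [_|ge]; first by rewrite cats1.
  have -> : n = size a by apply/eqP; rewrite eqn_leq nle.
  by rewrite subnn drop_size.
have -> : (if n < size a then take n a else a ++ take (n - size a) [:: c]) = take n a.
  case: ltnP => // ge; have -> : n = size a by apply/eqP; rewrite eqn_leq nle.
  by rewrite subnn take0 cats0 take_size.
split; first by rewrite cat_rcons.
right with (K ts DPop m (insub_bseq Qm (c :: acc)) o w
  (act (None, MoveLeft) (popped (rcons pre None ++ map Some a) j.+1))) => //.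
rewrite map_cat /= catA; move: (rcons pre None ++ map Some a) => X.
have -> : act (None, MoveLeft) (popped X j.+1) =
   act (None, MoveLeft) (act (None, MoveLeft) (popped (X ++ [:: Some c]) j)).
  by rewrite /popped map_cat catrev_catl.
eapply step_ctl; first by rewrite /popped map_cat catrev_catl /= lt.
all: by rewrite ?act_stay.
Qed.

Lemma encode3 x w a : encode [:: x; w; a] =
  map Some x ++ None :: map Some w ++ None :: map Some a ++ [:: None].
Proof. by rewrite /encode /= cats0 !cat_rcons -cats1. Qed.

Lemma reach_decide x w a T :
    computes_within M (encode [:: x; w; take (size a - pop (minn (size w) b)) a])
      (encode [:: [:: dc x w (take (size a - pop (minn (size w) b)) a)]]) T ->
  exists k, [/\ reach (4 * size (encode [:: x; w; a]) + T + 10) (init W (encode [:: x; w; a])) k,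
    step k = None & output k = encode [:: [:: pop_decide x w a]]].
Proof.
set m := minn (size w) b; set n := size a - pop m => cw.
set ts := blank_tapes M; set N := size (encode [:: x; w; a]).
have mb : m < b.+1 by rewrite ltnS geq_minr.
pose mo : 'I_b.+1 := inord m; have moE : mo = m :> nat by rewrite inordK.
have acc0 : size ([bseq] : Qm.-bseq bool) <= pop mo by [].
pose la := map Some a ++ [:: None]; pose lw := map Some w ++ None :: la.
pose pre := (map Some x ++ [:: None]) ++ map Some w; pose blanks j := zip_tape (nseq j None).
have r1 := @reach_copy DInput ord0 [bseq] ts 0 x [::] (None :: lw)
  ltac:(by move=> c o w' t ->).
have s1 : step (K ts DInput ord0 [bseq] (blanks (0 + size x) (None :: lw) [::]) blank_tape
      (written (map Some x))) =
    Some (K ts DCoins ord0 [bseq] (blanks (size x).+1 lw [::]) blank_tape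
      (written (map Some x ++ [:: None]))).
  by ctl_step; rewrite cats1 -written_rcons.
have := @reach_coins ts (size x).+1 w (map Some x ++ [:: None]) (None :: la) ord0 [bseq].
rewrite add0n -/m -/mo -/pre => r2.
have s2 : step (K ts DCoins mo [bseq] (blanks ((size x).+1 + size w) (None :: la) [::]) blank_tape
      (written pre)) =
    Some (K ts DAnswers mo [bseq] (blanks ((size x).+1 + size w).+1 la [::]) blank_tape
      (written (rcons pre None))).
  by ctl_step; rewrite -written_rcons.
have r3 := @reach_copy DAnswers mo [bseq] ts ((size x).+1 + size w).+1 a (rcons pre None) [:: None]
  ltac:(by move=> c o w' t ->).
set z := ((size x).+1 + size w).+1 + size a in r3.
have s3 : step (K ts DAnswers mo [bseq] (blanks z [:: None] [::]) blank_tape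
      (written (rcons pre None ++ map Some a))) =
    Some (K ts DPop mo [bseq] (blanks z.+1 [::] [::]) blank_tape
      (act (None, MoveLeft) (popped (rcons pre None ++ map Some a) 0))).
  by ctl_step.
have [acc [j [accE r4]]] := reach_pop ts (blanks z.+1 [::] [::]) blank_tape pre a 0 acc0.
rewrite /= moE subn0 -/n cats0 in accE r4.
set u := rcons pre None ++ map Some (take n a) in r4.
have s5 : step (K ts DSep mo acc (blanks z.+1 [::] [::]) blank_tape (popped u j)) =
    Some (K ts DTurn mo acc (blanks z.+1 [::] [::]) blank_tape (popped (rcons u None) j.-1)).
  by ctl_step; rewrite /popped map_rcons -cats1 catrev_catl; case: (j).
have s6 : step (K ts DTurn mo acc (blanks z.+1 [::] [::]) blank_tape (popped (rcons u None) j.-1)) =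
    Some (K ts DRewind mo acc (blanks z.+1 [::] [::]) blank_tape
      (act (None, MoveLeft) (popped (rcons u None) j.-1))).
  by ctl_step.
have hl t : tcur t != None -> step (K ts DRewind mo acc (blanks z.+1 [::] [::]) blank_tape t) =
    Some (K ts DRewind mo acc (blanks z.+1 [::] [::]) blank_tape (act (tcur t, MoveLeft) t)).
  by case: t => l [s|] r // _; ctl_step.
pose enter t : config W := wconf (inl (start M, (DVerdict, mo, acc) : dstate))
  (blanks z.+1 [::] [::]) blank_tape (set_tape0 ts t).
have hr t : tcur t = None -> step (K ts DRewind mo acc (blanks z.+1 [::] [::]) blank_tape t) =
    Some (enter (act (None, MoveRight) t)).
  case: t => l [//|] r _; rewrite (@step_ctl_gen _ _ _ _ _ _ _ _ _ true (DVerdict, mo, acc)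
    (None, Stay) (None, Stay) (None, MoveRight)) //.
have r7 := rewind hl hr (rcons u None) [::] (nseq j.-1 None) (erefl : head None [::] = None).
rewrite /= cats0 in r7.
have uE : rcons u None = encode [:: x; w; take n a].
  by rewrite encode3 /u /pre -!cats1 -!catA.
rewrite -uE in cw.
have [||ts' r8 outE] := @reach_call M dstate (DInput, ord0, [bseq]) dctl _ _ _ (DVerdict, mo, acc)
  (blanks z.+1 [::] [::]) blank_tape [:: None] (nseq j.-1.+1 None) cw.
- by case=> [|i] //=; rewrite nth_nil.
- by move=> i; rewrite nth_nseq if_same.
rewrite /encode /= in outE.
set v := dc x w (take n a) in outE.
have tc : tcur (ts' ord0) = Some (Some v).
  by case: (ts' ord0) outE => l [s|] r //= [->].
(* The input has been erased from tape 0, so the verdict bit followed by a separator becomes the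
   whole output. *)
pose o1 := Tape (Some (Some (comb m acc v)) :: nseq z.+1 None) None [::].
have s9 : step (K ts' DVerdict mo acc (blanks z.+1 [::] [::]) blank_tape (ts' ord0)) =
    Some (K ts' DEnd mo acc o1 blank_tape (ts' ord0)).
  eapply step_ctl; first by rewrite tc.
  - by rewrite /o1 -moE.
  - by [].
  - by rewrite -tc act_stay.
pose o2 := Tape (nseq z.+1 None) (Some (Some (comb m acc v))) [:: Some None].
have s10 : step (K ts' DEnd mo acc o1 blank_tape (ts' ord0)) =
    Some (K ts' DHalt mo acc o2 blank_tape (ts' ord0)).
  by ctl_step.
exists (K ts' DHalt mo acc o2 blank_tape (ts' ord0)); split.
- rewrite init_wrapper.
  have -> : input_tape (encode [:: x; w; a]) = blanks 0 (map Some x ++ None :: lw) [::].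
    by rewrite encode3 /blanks /zip_tape cats0.
  have r := (reach_trans r1 (reach_trans (reach1 s1) (reach_trans r2
    (reach_trans (reach1 s2) (reach_trans r3 (reach_trans (reach1 s3) (reach_trans r4
    (reach_trans (reach1 s5) (reach_trans (reach1 s6) (reach_trans r7 (reach_trans r8
    (reach_trans (reach1 s9) (reach1 s10))))))))))))).
  apply: reach_leq r.
  rewrite uE /N !encode3 !size_cat /= !size_cat /= !size_cat /= !size_map size_take.
  by case: ltnP; lia.
- exact: step_ctl_halt.
- by rewrite output_ctl /= /pop_decide -/m -/n -accE.
Qed.
End Decide.

Lemma pop_decide_poly dc b Qm pop comb : (forall m, pop m <= Qm) ->
    poly_time (fun xwa : seq bool * seq bool * seq bool => [:: xwa.1.1; xwa.1.2; xwa.2])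
      (fun c : bool => [:: [:: c]]) (fun xwa => dc xwa.1.1 xwa.1.2 xwa.2) ->
  poly_time (fun xwa : seq bool * seq bool * seq bool => [:: xwa.1.1; xwa.1.2; xwa.2])
    (fun c : bool => [:: [:: c]])
    (fun xwa => pop_decide dc b pop comb xwa.1.1 xwa.1.2 xwa.2).
Proof.
move=> popQ [M [C [d h]]].
apply: (@poly_timeP _ _ _ _ _
  (wrapper M ((DInput, ord0, [bseq]) : dstate b Qm) (dctl pop comb))
  (fun N => 4 * N + (C * N ^ d + C) + 10)).
  apply: pboundD; last exact: pbound_const.
  apply: pboundD; last exact: pbound_poly.
  by apply: pboundM; [apply: pbound_const | apply: pbound_id].
move=> [[x w] a] /=; apply: reach_decide => //.
(* The called machine gets a word no longer than the input, so its time bound may be taken at the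
   input length. *)
pose n := size a - pop (minn (size w) b).
apply: computes_withinW (h (x, w, take n a)); apply: leq_poly.
rewrite !encode3 !size_cat /= !size_cat /= !size_cat /= !size_map size_take.
by case: ltnP; lia.
Qed.

(** * The machine for the queries *)

Fixpoint incr (a : seq bool) : seq bool :=
  match a with
  | [::] => [:: true]
  | true :: a' => false :: incr a'
  | false :: a' => true :: a'
  end.

(** With the least significant bit first, adding [2 ^ n] keeps the [n] low bits, padded with zeros
    if missing, and increments the rest. *)
Fixpoint add_pow (n : nat) (a : seq bool) : seq bool :=
  if n is n'.+1 then head false a :: add_pow n' (behead a) else incr a.

Lemma position_incr a : position (incr a) = (position a).+1.
Proof. by elim: a => //= -[] a IH //=; rewrite ?IH; lia. Qed.

Lemma position_add_pow n a : position (add_pow n a) = position a + 2 ^ n.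
Proof.
elim: n a => [|n IH] a /=; first by rewrite position_incr addn1.
by rewrite IH expnS; case: a => [|c a] /=; lia.
Qed.

Fixpoint mealy (S : Type) (next : S -> bool -> S) (out : S -> bool -> bool) (s : S)
    (w : seq bool) : seq bool :=
  if w is c :: w' then out s c :: mealy next out (next s c) w' else [::].

Variant qtag := QInput | QOnes | QCoins | QRewind0 | QRewindT | QList | QAdd | QIncr
  | QCopy | QRewind1 | QSeed | QMealy | QRewind2 | QRewindO | QHalt.

Definition qtags := [:: QInput; QOnes; QCoins; QRewind0; QRewindT; QList; QAdd; QIncr;
  QCopy; QRewind1; QSeed; QMealy; QRewind2; QRewindO; QHalt].

Definition qtag_code (t : qtag) : 'I_15 :=
  match t with
  | QInput => inord 0 | QOnes => inord 1 | QCoins => inord 2 | QRewind0 => inord 3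
  | QRewindT => inord 4 | QList => inord 5 | QAdd => inord 6 | QIncr => inord 7
  | QCopy => inord 8 | QRewind1 => inord 9 | QSeed => inord 10 | QMealy => inord 11
  | QRewind2 => inord 12 | QRewindO => inord 13 | QHalt => inord 14
  end.

Lemma qtag_codeK : cancel qtag_code (nth QHalt qtags : 'I_15 -> qtag).
Proof. by case; rewrite /= inordK. Qed.

HB.instance Definition _ := Finite.copy qtag (can_type qtag_codeK).

Section Queries.
Variables (qs : seq bool -> seq bool -> seq (seq bool)) (np : nat).
Variables (S : finType) (next : S -> bool -> S) (out : S -> bool -> bool) (L : seq S).

(** Without coins there are no extra queries, because their number must be bounded by a multiple of
    the number of coins. *)
Definition shifted_queries (x w : seq bool) : seq (seq bool) :=
  map (add_pow (np + size w)) (qs x w) ++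
  if nilp w then [::] else [seq mealy next out s (nseq np true ++ w) | s <- L].

(** The components are the phase, whether [w] is nonempty, the number of ones still to be written,
    the position in [L], and the state of the automaton. *)
Definition qstate := (qtag * bool * 'I_np.+1 * 'I_(size L).+1 * option S)%type.

(* Keeps 1^np w on the work tape while the machine for [qs] is run on x # w #;
   each query it returns is then shifted by adding 2^(np + size w), scanning the
   work tape as a counter, and the extra queries are the outputs of the automaton
   on the work tape, started in each state of [L]. *)
Definition qctl (p : qstate) (o w t : cell) :
    option (bool * qstate * (cell * move) * (cell * move) * (cell * move)) :=
  let: (tag, fl, k, j, s) := p in
  let go tag' ao aw at' := Some (false, (tag', fl, k, j, s) : qstate, ao, aw, at') in
  match tag with
  | QInput =>
      match o with
      | Some (Some _) => go QInput (None, MoveRight) (w, Stay) (o, MoveRight)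
      | Some None => go QOnes (None, MoveRight) (w, Stay) (o, MoveRight)
      | None => None
      end
  | QOnes =>
      if val k == 0 then go QCoins (o, Stay) (w, Stay) (t, Stay)
      else Some (false, (QOnes, fl, inord k.-1, j, s) : qstate,
             (o, Stay), (Some (Some true), MoveRight), (t, Stay))
  | QCoins =>
      match o with
      | Some (Some _) => Some (false, (QCoins, true, k, j, s) : qstate,
             (None, MoveRight), (o, MoveRight), (o, MoveRight))
      | Some None => go QRewind0 (None, MoveRight) (w, MoveLeft) (o, MoveRight)
      | None => None
      end
  | QRewind0 =>
      if w is None then go QRewindT (o, Stay) (None, MoveRight) (t, MoveLeft)
      else go QRewind0 (o, Stay) (w, MoveLeft) (t, Stay)
  | QRewindT =>
      if t is None then
        Some (true, (QList, fl, k, j, s) : qstate, (o, Stay), (w, Stay), (None, MoveRight))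
      else go QRewindT (o, Stay) (w, Stay) (t, MoveLeft)
  | QList =>
      if t is None then
        if fl then go QSeed (o, Stay) (w, Stay) (t, Stay)
        else go QRewindO (o, MoveLeft) (w, Stay) (t, Stay)
      else go QAdd (o, Stay) (w, Stay) (t, Stay)
  | QAdd =>
      if w is None then go QIncr (o, Stay) (w, Stay) (t, Stay)
      else if t is Some (Some _) then go QAdd (t, MoveRight) (w, MoveRight) (t, MoveRight)
      else go QAdd (Some (Some false), MoveRight) (w, MoveRight) (t, Stay)
  | QIncr =>
      match t with
      | Some (Some true) => go QIncr (Some (Some false), MoveRight) (w, Stay) (t, MoveRight)
      | Some (Some false) => go QCopy (Some (Some true), MoveRight) (w, Stay) (t, MoveRight)
      | _ => go QCopy (Some (Some true), MoveRight) (w, Stay) (t, Stay)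
      end
  | QCopy =>
      if t is Some (Some _) then go QCopy (t, MoveRight) (w, Stay) (t, MoveRight)
      else go QRewind1 (Some None, MoveRight) (w, MoveLeft) (t, MoveRight)
  | QRewind1 =>
      if w is None then go QList (o, Stay) (None, MoveRight) (t, Stay)
      else go QRewind1 (o, Stay) (w, MoveLeft) (t, Stay)
  | QSeed =>
      if nth None (map Some L) j is Some s' then
        Some (false, (QMealy, fl, k, j, Some s') : qstate, (o, Stay), (w, Stay), (t, Stay))
      else go QRewindO (o, MoveLeft) (w, Stay) (t, Stay)
  | QMealy =>
      match w, s with
      | Some (Some c), Some s' => Some (false, (QMealy, fl, k, j, Some (next s' c)) : qstate,
             (Some (Some (out s' c)), MoveRight), (w, MoveRight), (t, Stay))
      | _, _ => go QRewind2 (Some None, MoveRight) (w, MoveLeft) (t, Stay)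
      end
  | QRewind2 =>
      if w is None then
        Some (false, (QSeed, fl, k, inord j.+1, s) : qstate, (o, Stay), (None, MoveRight), (t, Stay))
      else go QRewind2 (o, Stay) (w, MoveLeft) (t, Stay)
  | QRewindO =>
      if o is None then go QHalt (None, MoveRight) (w, Stay) (t, Stay)
      else go QRewindO (o, MoveLeft) (w, Stay) (t, Stay)
  | QHalt => None
  end.

Variable M : TM.
Definition qstart : qstate := (QInput, false, ord_max, ord0, None).
Local Notation W := (wrapper M qstart qctl).
Local Notation K ts tag fl k j s := (@ctl M qstate qstart qctl ts (tag, fl, k, j, s)).

Definition written g (u : seq symbol) := zip_tape (catrev (map Some u) g) [::] [::].

Lemma writtenS g u c : act (Some c, MoveRight) (written g u) = written g (rcons u c).
Proof. by rewrite /written map_rcons -cats1 catrev_catl. Qed.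

Lemma written_cat g u u' : written g (u ++ u') = written (catrev (map Some u) g) u'.
Proof. by rewrite /written map_cat catrev_catl. Qed.

Lemma reach_qinput ts fl k j s w n x u l :
  reach (size x)
    (K ts QInput fl k j s (zip_tape (nseq n None) (map Some x ++ l) [::]) w (written [::] u))
    (K ts QInput fl k j s (zip_tape (nseq (n + size x) None) l [::]) w
      (written [::] (u ++ map Some x))).
Proof.
elim: x n u => [|c x IH] n u /=; first by rewrite addn0 cats0; left.
right with (K ts QInput fl k j s (zip_tape (nseq n.+1 None) (map Some x ++ l) [::])
              w (written [::] (rcons u (Some c)))).
  by ctl_step; exact: writtenS.
by rewrite -addSnnS -cat_rcons; apply: IH.
Qed.

Lemma reach_qones ts fl (k : 'I_np.+1) j s o t u :
  reach k (K ts QOnes fl k j s o (written [::] u) t)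
    (K ts QOnes fl ord0 j s o (written [::] (u ++ nseq k (Some true))) t).
Proof.
case: k => n lt; elim: n lt u => [|n IH] lt u /=.
  by rewrite cats0 (_ : Ordinal lt = ord0); [left | apply: val_inj].
have lt' := ltnW lt.
right with (K ts QOnes fl (Ordinal lt') j s o (written [::] (rcons u (Some true))) t).
  rewrite (_ : Ordinal lt' = inord (Ordinal lt).-1).
    by ctl_step; exact: writtenS.
  by apply: val_inj; rewrite /= inordK.
by rewrite -cat_rcons; apply: IH.
Qed.

Lemma reach_qcoins ts fl k j s n x uw ut l :
  reach (size x)
    (K ts QCoins fl k j s (zip_tape (nseq n None) (map Some x ++ l) [::])
      (written [::] uw) (written [::] ut))
    (K ts QCoins (fl || ~~ nilp x) k j s (zip_tape (nseq (n + size x) None) l [::])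
      (written [::] (uw ++ map Some x)) (written [::] (ut ++ map Some x))).
Proof.
elim: x fl n uw ut => [|c x IH] fl n uw ut /=; first by rewrite addn0 !cats0 orbF; left.
right with (K ts QCoins true k j s (zip_tape (nseq n.+1 None) (map Some x ++ l) [::])
              (written [::] (rcons uw (Some c))) (written [::] (rcons ut (Some c)))).
  by ctl_step; exact: writtenS.
rewrite -addSnnS -!cat_rcons orbT; exact: IH.
Qed.

Lemma reach_qadd ts fl k j s ws a go gw rw h l r :
  exists h',
    reach (size ws).+1
    (K ts QAdd fl k j s (written go [::]) (zip_tape gw ws (None :: rw))
       (zip_tape h (map Some a ++ None :: l) r))
    (K ts QIncr fl k j s (written go (map Some (take (size ws) (add_pow (size ws) a))))
       (zip_tape (catrev (map Some ws) gw) [::] (None :: rw))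
       (zip_tape h' (map Some (drop (size ws) a) ++ None :: l) r)).
Proof.
elim: ws a go gw h => [|c ws IH] a go gw h /=.
  by exists h; rewrite take0 drop0; apply: reach1; ctl_step.
case: a => [|c' a] /=.
  have [h' rr] := IH [::] (Some (Some false) :: go) (Some c :: gw) h.
  exists h'; right with (K ts QAdd fl k j s (written (Some (Some false) :: go) [::])
     (zip_tape (Some c :: gw) ws (None :: rw)) (zip_tape h (None :: l) r)) => //.
  by ctl_step.
have [h' rr] := IH a (Some (Some c') :: go) (Some c :: gw) (Some (Some c') :: h).
exists h'; right with (K ts QAdd fl k j s (written (Some (Some c') :: go) [::])
   (zip_tape (Some c :: gw) ws (None :: rw))
   (zip_tape (Some (Some c') :: h) (map Some a ++ None :: l) r)) => //.
by ctl_step.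
Qed.

Lemma reach_qcopy ts fl k j s a go w h l r : tcur w = None ->
  exists h',
    reach (size a).+1
    (K ts QCopy fl k j s (written go [::]) w (zip_tape h (map Some a ++ None :: l) r))
    (K ts QRewind1 fl k j s (written go (rcons (map Some a) None))
       (act (None, MoveLeft) w) (zip_tape h' l r)).
Proof.
move=> w0; elim: a go h => [|c a IH] go h /=.
  by exists (Some None :: h); apply: reach1; ctl_step; rewrite -w0.
have [h' rr] := IH (Some (Some c) :: go) (Some (Some c) :: h).
exists h'; right with (K ts QCopy fl k j s (written (Some (Some c) :: go) [::]) w
   (zip_tape (Some (Some c) :: h) (map Some a ++ None :: l) r)) => //.
by ctl_step.
Qed.

Lemma reach_qincr ts fl k j s a go w h l r : tcur w = None ->
  exists h',
    reach (size a).+2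
    (K ts QIncr fl k j s (written go [::]) w (zip_tape h (map Some a ++ None :: l) r))
    (K ts QRewind1 fl k j s (written go (rcons (map Some (incr a)) None))
       (act (None, MoveLeft) w) (zip_tape h' l r)).
Proof.
move=> w0; elim: a go h => [|c a IH] go h /=.
  have [h' rr] := reach_qcopy ts fl k j s [::] (Some (Some true) :: go) h l r w0.
  exists h'; right with (K ts QCopy fl k j s (written (Some (Some true) :: go) [::]) w
     (zip_tape h (None :: l) r)) => //.
  by ctl_step.
case: c.
  have [h' rr] := IH (Some (Some false) :: go) (Some (Some true) :: h).
  exists h'; right with (K ts QIncr fl k j s (written (Some (Some false) :: go) [::]) w
    (zip_tape (Some (Some true) :: h) (map Some a ++ None :: l) r)) => //.
  by ctl_step.
have [h' rr] := reach_qcopy ts fl k j s a (Some (Some true) :: go) (Some (Some false) :: h) l r w0.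
exists h'; right with (K ts QCopy fl k j s (written (Some (Some true) :: go) [::]) w
  (zip_tape (Some (Some false) :: h) (map Some a ++ None :: l) r)).
  by ctl_step.
exact: reach_leq rr.
Qed.

(** The two parts are the outputs of the phases [QAdd] and [QIncr]. *)
Lemma add_powE n a : add_pow n a = take n (add_pow n a) ++ incr (drop n a).
Proof. by elim: n a => [|n IH] [|c a] //=; rewrite ?take0 // {1}IH. Qed.

Lemma encode_cons a l : encode (a :: l) = map Some a ++ None :: encode l.
Proof. by rewrite /encode /= cat_rcons. Qed.

Lemma reach_qlist ts fl k j s ws as' go rw h r : head None r = None ->
  exists h',
    reach ((2 * size ws + 7) * size (encode as'))
    (K ts QList fl k j s (written go [::]) (zip_tape [:: None] ws (None :: rw))
      (zip_tape h (encode as') r))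
    (K ts QList fl k j s (written go (encode (map (add_pow (size ws)) as')))
      (zip_tape [:: None] ws (None :: rw)) (zip_tape h' [::] r)).
Proof.
move=> r0; elim: as' go h => [|a as' IH] go h; first by exists h; left.
rewrite [encode (map _ _)]encode_cons encode_cons.
set wt := zip_tape [:: None] ws (None :: rw).
have s1 : step (K ts QList fl k j s (written go [::]) wt
      (zip_tape h (map Some a ++ None :: encode as') r)) =
    Some (K ts QAdd fl k j s (written go [::]) wt
      (zip_tape h (map Some a ++ None :: encode as') r)).
  by case: (a) => [|c a']; ctl_step.
have [h1 r1] := reach_qadd ts fl k j s ws a go [:: None] rw h (encode as') r.
have [h2 r2] := reach_qincr ts fl k j s (drop (size ws) a)
  (catrev (map Some (map Some (take (size ws) (add_pow (size ws) a)))) go) h1 (encode as') r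
  (erefl : tcur (zip_tape (catrev (map Some ws) [:: None]) [::] (None :: rw)) = None).
set o2 := written _ (rcons _ _) in r2.
have hl t : tcur t != None -> step (K ts QRewind1 fl k j s o2 t (zip_tape h2 (encode as') r)) =
    Some (K ts QRewind1 fl k j s o2 (act (tcur t, MoveLeft) t) (zip_tape h2 (encode as') r)).
  by case: t => lt [c|] rt // _; ctl_step.
have hr t : tcur t = None -> step (K ts QRewind1 fl k j s o2 t (zip_tape h2 (encode as') r)) =
    Some (K ts QList fl k j s o2 (act (None, MoveRight) t) (zip_tape h2 (encode as') r)).
  by case: t => lt [//|] rt _; ctl_step.
have r3 := rewind (K' := fun t => K ts QList fl k j s o2 t (zip_tape h2 (encode as') r))
  hl hr ws [::] rw (erefl : head None [:: None] = None).
rewrite /= cats0 -/wt in r3.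
pose o3 := map Some (add_pow (size ws) a) ++ [:: None].
have o2E : o2 = written (catrev (map Some o3) go) [::].
  transitivity (written go o3); last by rewrite -[in LHS](cats0 o3) written_cat.
  by rewrite /o2 -written_cat -cats1 catA -map_cat -add_powE.
have [h' r4] := IH (catrev (map Some o3) go) h2.
exists h'; rewrite (_ : _ (add_pow _ _) ++ None :: _ = o3 ++ encode (map (add_pow (size ws)) as'));
  last by rewrite -catA.
rewrite written_cat.
rewrite o2E in r2 r3.
apply: reach_leq (reach_trans (reach1 s1) (reach_trans r1 (reach_trans r2 (reach_trans r3 r4)))).
rewrite size_cat /= size_map size_drop.
have := leq_subr (size ws) (size a).
rewrite mulnDr mulnS; nia.
Qed.

Lemma reach_qmealy ts fl k j s ws go gw rw t :
  reach (size ws).+1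
    (K ts QMealy fl k j (Some s) (written go [::]) (zip_tape gw (map Some ws) (None :: rw)) t)
    (K ts QRewind2 fl k j (Some (foldl next s ws))
      (written go (rcons (map Some (mealy next out s ws)) None))
      (act (None, MoveLeft) (zip_tape (catrev (map Some (map Some ws)) gw) [::] (None :: rw))) t).
Proof.
elim: ws s go gw => [|c ws IH] s go gw /=; first by apply: reach1; ctl_step.
right with (K ts QMealy fl k j (Some (next s c)) (written (Some (Some (out s c)) :: go) [::])
  (zip_tape (Some (Some c) :: gw) (map Some ws) (None :: rw)) t).
  by ctl_step.
exact: IH.
Qed.

Lemma reach_qseed ts fl k (j : 'I_(size L).+1) s ws go rw t :
  exists j' s',
    reach (size (drop j L) * (2 * size ws + 3) + 1)
      (K ts QSeed fl k j s (written go [::]) (zip_tape [:: None] (map Some ws) (None :: rw)) t)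
      (let o := written go (encode [seq mealy next out s ws | s <- drop j L]) in
       K ts QRewindO fl k j' s' (act (tcur o, MoveLeft) o)
         (zip_tape [:: None] (map Some ws) (None :: rw)) t).
Proof.
set wt := zip_tape [:: None] (map Some ws) (None :: rw).
case: j => j lt /=; move e: (drop j L) => L'.
elim: L' j lt e s go => [|s1 L' IH] j lt e s go.
  have jL : size L <= j by rewrite -subn_eq0 -size_drop e.
  exists (Ordinal lt), s; apply: reach1.
  have nj : nth None (map Some L) j = None by rewrite nth_default ?size_map.
  by eapply step_ctl; [rewrite /= nj; reflexivity | | | exact: act_stay].
have jL : j < size L by rewrite -subn_gt0 -size_drop e.
have nj : nth None (map Some L) j = Some s1.
  by rewrite (nth_map s1) // -[j]addn0 -nth_drop e.
have s1E : step (K ts QSeed fl k (Ordinal lt) s (written go [::]) wt t) =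
    Some (K ts QMealy fl k (Ordinal lt) (Some s1) (written go [::]) wt t).
  by eapply step_ctl; [rewrite /= nj; reflexivity | | | exact: act_stay].
have r1 := reach_qmealy ts fl k (Ordinal lt) s1 ws go [:: None] rw t.
set o1 := written go (rcons _ _) in r1; set s2 := foldl _ _ _ in r1.
have lt' : j.+1 < (size L).+1 by [].
have hl t' : tcur t' != None -> step (K ts QRewind2 fl k (Ordinal lt) (Some s2) o1 t' t) =
    Some (K ts QRewind2 fl k (Ordinal lt) (Some s2) o1 (act (tcur t', MoveLeft) t') t).
  by case: t' => ll [c|] rr // _; ctl_step.
have hr t' : tcur t' = None -> step (K ts QRewind2 fl k (Ordinal lt) (Some s2) o1 t' t) =
    Some (K ts QSeed fl k (Ordinal lt') (Some s2) o1 (act (None, MoveRight) t') t).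
  case: t' => ll [//|] rr _; rewrite (_ : Ordinal lt' = inord (Ordinal lt).+1); first by ctl_step.
  by apply: val_inj; rewrite /= inordK.
have r2 := rewind (K' := fun t' => K ts QSeed fl k (Ordinal lt') (Some s2) o1 t' t)
  hl hr (map Some ws) [::] rw (erefl : head None [:: None] = None).
rewrite /= cats0 -/wt size_map in r2.
have e' : drop j.+1 L = L' by rewrite -addn1 addnC -drop_drop e /= drop0.
pose u := map Some (mealy next out s1 ws) ++ [:: None].
have [j' [s' r3]] := IH j.+1 lt' e' (Some s2) (catrev (map Some u) go).
exists j', s'; rewrite /= encode_cons.
rewrite (_ : _ (mealy _ _ _ _) ++ None :: _ = u ++ encode [seq mealy next out s ws | s <- L']);
  last by rewrite -catA.
rewrite written_cat.
have o1E : o1 = written (catrev (map Some u) go) [::].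
  by rewrite /o1 -cats1 -/u -[in LHS](cats0 u) written_cat.
rewrite o1E in r1 r2.
apply: reach_leq (reach_trans (reach1 s1E) (reach_trans r1 (reach_trans r2 r3))).
nia.
Qed.

Lemma size_mealy s ws : size (mealy next out s ws) = size ws.
Proof. by elim: ws s => //= c ws IH s; rewrite IH. Qed.

Lemma size_incr a : size (incr a) <= (size a).+1.
Proof. by elim: a => // -[] a /=; lia. Qed.

Lemma size_add_pow n a : size (add_pow n a) <= n + size a + 1.
Proof.
elim: n a => [|n IH] a /=; first by have := size_incr a; lia.
by have := IH (behead a); rewrite size_behead; lia.
Qed.

Lemma size_encode_shifted n l :
  size (encode (map (add_pow n) l)) <= (n + 2) * size (encode l).
Proof.
elim: l => //= a l IH; rewrite !encode_cons !size_cat /= !size_map.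
have := size_add_pow n a; nia.
Qed.

Lemma size_encode_mealy ws l :
  size (encode [seq mealy next out s ws | s <- l]) = size l * (size ws + 1).
Proof.
elim: l => //= s l IH; rewrite encode_cons size_cat /= size_map size_mealy IH; lia.
Qed.

Lemma encode2 x w : encode [:: x; w] = map Some x ++ None :: map Some w ++ [:: None].
Proof. by rewrite !encode_cons. Qed.

Lemma zip_tape_prefix t : exists2 r, head None r = None
  & t = zip_tape (tleft t) (nonblank_prefix (tcur t :: tright t)) r.
Proof.
suff [r r0 e] : exists2 r, head None r = None &
    tcur t :: tright t = map Some (nonblank_prefix (tcur t :: tright t)) ++ r.
  by exists r => //; rewrite /zip_tape -e; case: (t).
elim: (tcur t :: tright t) => [|[a|] s [r r0 e]] /=; first by exists [::].
  by exists r => //; rewrite {1}e.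
by exists (None :: s).
Qed.

Lemma reach_qtail ts fl k s ws go rw h r : head None r = None ->
  exists j' s',
    reach (size L * (2 * size ws + 3) + 2)
      (K ts QList fl k ord0 s (written go [::]) (zip_tape [:: None] (map Some ws) (None :: rw))
        (zip_tape h [::] r))
      (let o := written go (encode (if fl then [seq mealy next out s ws | s <- L] else [::])) in
       K ts QRewindO fl k j' s' (act (tcur o, MoveLeft) o)
         (zip_tape [:: None] (map Some ws) (None :: rw)) (zip_tape h [::] r)).
Proof.
move=> r0; have tc : tcur (zip_tape h [::] r) = None by [].
case: fl.
  have [j' [s' rr]] := reach_qseed ts true k ord0 s ws go rw (zip_tape h [::] r).
  rewrite /= drop0 in rr; exists j', s'.
  apply: reach_leq (reach_trans (reach1 _) rr); first by lia.
  by eapply step_ctl; [rewrite tc; reflexivity | | | rewrite -tc; exact: act_stay].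
exists ord0, s; apply: reach_leq (reach1 _); first by lia.
by eapply step_ctl; [rewrite tc; reflexivity | | | rewrite -tc; exact: act_stay].
Qed.

Lemma reach_queries x w T :
    computes_within M (encode [:: x; w]) (encode (qs x w)) T ->
  let N := size (encode [:: x; w]) in
  exists k, [/\ reach (4 * N + 3 * np + T + 20 + (2 * (np + N) + 7) * (N + T + 1) +
      size L * (2 * (np + N) + 3) + (np + N + 2) * (N + T + 1) + size L * (np + N + 1))
      (init W (encode [:: x; w])) k,
    step k = None & output k = encode (shifted_queries x w)].
Proof.
move=> cw N; set ts := blank_tapes M; pose blanks j := zip_tape (nseq j None).
pose lw := map Some w ++ [:: None]; pose px := map Some x ++ [:: None].
pose ws := nseq np true ++ w; pose fl := ~~ nilp w.
have r1 := @reach_qinput ts false ord_max ord0 None blank_tape 0 x [::] (None :: lw).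
have s1 : step (K ts QInput false ord_max ord0 None (blanks (0 + size x) (None :: lw) [::])
      blank_tape (written [::] (map Some x))) =
    Some (K ts QOnes false ord_max ord0 None (blanks (size x).+1 lw [::])
      (written [::] [::]) (written [::] px)).
  by ctl_step; rewrite /px cats1 -writtenS.
have r2 := @reach_qones ts false ord_max ord0 None (blanks (size x).+1 lw [::])
  (written [::] px) [::].
set u1 := [::] ++ _ in r2.
have s2 : step (K ts QOnes false ord0 ord0 None (blanks (size x).+1 lw [::])
      (written [::] u1) (written [::] px)) =
    Some (K ts QCoins false ord0 ord0 None (blanks (size x).+1 lw [::])
      (written [::] u1) (written [::] px)).
  by ctl_step.
have r3 := @reach_qcoins ts false ord0 ord0 None (size x).+1 w u1 px [:: None].
set z := (size x).+1 + size w; rewrite -/z -[false || _]/fl in r3.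
have wsE : u1 ++ map Some w = map Some ws by rewrite /u1 /ws map_cat map_nseq.
rewrite wsE in r3.
have eE : rcons (px ++ map Some w) None = encode [:: x; w].
  by rewrite encode2 /px -cats1 -!catA.
have s3 : step (K ts QCoins fl ord0 ord0 None (blanks z [:: None] [::])
      (written [::] (map Some ws)) (written [::] (px ++ map Some w))) =
    Some (K ts QRewind0 fl ord0 ord0 None (blanks z.+1 [::] [::])
      (act (None, MoveLeft) (zip_tape (catrev (map Some (map Some ws)) [::]) [::] [:: None]))
      (written [::] (encode [:: x; w]))).
  by ctl_step; rewrite -eE -writtenS.
set o := blanks z.+1 [::] [::] in s3.
set t1 := written [::] (encode [:: x; w]) in s3.
have hl t : tcur t != None -> step (K ts QRewind0 fl ord0 ord0 None o t t1) =
    Some (K ts QRewind0 fl ord0 ord0 None o (act (tcur t, MoveLeft) t) t1).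
  by case: t => l [s|] r // _; ctl_step.
have hr t : tcur t = None -> step (K ts QRewind0 fl ord0 ord0 None o t t1) =
    Some (K ts QRewindT fl ord0 ord0 None o (act (None, MoveRight) t) (act (None, MoveLeft) t1)).
  by case: t => l [//|] r _; ctl_step.
have r4 := rewind (K' := fun t => K ts QRewindT fl ord0 ord0 None o t (act (None, MoveLeft) t1))
  hl hr (map Some ws) [::] [::] (erefl : head None [::] = None).
rewrite /= cats0 size_map in r4.
set wt := zip_tape [:: None] (map Some ws) [:: None] in r4.
have hlT t : tcur t != None -> step (K ts QRewindT fl ord0 ord0 None o wt t) =
    Some (K ts QRewindT fl ord0 ord0 None o wt (act (tcur t, MoveLeft) t)).
  by case: t => l [s|] r // _; ctl_step.
pose enter t : config W := wconf (inl (start M, (QList, fl, ord0, ord0, None) : qstate))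
  o wt (set_tape0 ts t).
have hrT t : tcur t = None -> step (K ts QRewindT fl ord0 ord0 None o wt t) =
    Some (enter (act (None, MoveRight) t)).
  case: t => l [//|] r _; rewrite (@step_ctl_gen _ _ _ _ _ _ _ _ _ true
    (QList, fl, ord0, ord0, None) (tcur o, Stay) (tcur wt, Stay) (None, MoveRight)) //.
have r5 := rewind (K' := enter) hlT hrT (encode [:: x; w]) [::] [::] (erefl : head None [::] = None).
rewrite /= cats0 in r5.
have [||ts' r6 outE] := @reach_call M qstate qstart qctl _ _ _ (QList, fl, ord0, ord0, None)
  o wt [:: None] [:: None] cw.
- by case=> [|i] //=; rewrite nth_nil.
- by case=> [|i] //=; rewrite nth_nil.
have [r rE tE] := zip_tape_prefix (ts' ord0); rewrite outE in tE.
rewrite tE in r6.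
have [h r7] := @reach_qlist ts' fl ord0 ord0 None (map Some ws) (qs x w) (nseq z.+1 None) [::]
  (tleft (ts' ord0)) r rE.
rewrite size_map in r7; set n := size ws in r7.
set e1 := encode (map _ _) in r7.
have r7' : reach ((2 * n + 7) * size (encode (qs x w)))
    (K ts' QList fl ord0 ord0 None o wt (zip_tape (tleft (ts' ord0)) (encode (qs x w)) r))
    (K ts' QList fl ord0 ord0 None (written (catrev (map Some e1) (nseq z.+1 None)) [::]) wt
      (zip_tape h [::] r)).
  by rewrite -[written _ [::]]written_cat cats0.
have [j' [s' r8]] := @reach_qtail ts' fl ord0 None ws (catrev (map Some e1) (nseq z.+1 None))
  [::] h r rE.
set e2 := encode _ in r8.
have outEq : e1 ++ e2 = encode (shifted_queries x w).
  rewrite /shifted_queries /encode map_cat flatten_cat -/(encode _) -/(encode _).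
  by rewrite /e1 /e2 /fl /n /ws size_cat size_nseq; case: nilp.
have w8 : written (catrev (map Some e1) (nseq z.+1 None)) e2 =
    written (nseq z.+1 None) (encode (shifted_queries x w)) by rewrite -outEq written_cat.
rewrite w8 in r8.
set t3 := zip_tape h [::] r in r8.
have hlO t : tcur t != None -> step (K ts' QRewindO fl ord0 j' s' t wt t3) =
    Some (K ts' QRewindO fl ord0 j' s' (act (tcur t, MoveLeft) t) wt t3).
  case: t => l [c|] rr // _; eapply step_ctl; [reflexivity|reflexivity|reflexivity|exact: act_stay].
have hrO t : tcur t = None -> step (K ts' QRewindO fl ord0 j' s' t wt t3) =
    Some (K ts' QHalt fl ord0 j' s' (act (None, MoveRight) t) wt t3).
  case: t => l [//|] rr _; eapply step_ctl; [reflexivity|reflexivity|reflexivity|exact: act_stay].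
have r9 := rewind (K' := fun t => K ts' QHalt fl ord0 j' s' t wt t3) hlO hrO
  (encode (shifted_queries x w)) [::] [::] (erefl : head None (nseq z.+1 None) = None).
rewrite /= cats0 in r9.
exists (K ts' QHalt fl ord0 j' s' (zip_tape (None :: behead (nseq z.+1 None))
  (encode (shifted_queries x w)) [:: None]) wt t3); split; last 2 first.
- by apply: step_ctl_halt.
- rewrite output_ctl /zip_tape /=.
  set e := encode (shifted_queries x w).
  have nb u : nonblank_prefix (map Some u ++ [:: None]) = u by elim: u => //= a u ->.
  by rewrite -[RHS]nb; case: (e).
have rr := reach_trans r1 (reach_trans (reach1 s1) (reach_trans r2 (reach_trans (reach1 s2)
  (reach_trans r3 (reach_trans (reach1 s3) (reach_trans r4 (reach_trans r5 (reach_trans r6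
  (reach_trans r7' (reach_trans r8 r9)))))))))).
rewrite init_wrapper.
have -> : input_tape (encode [:: x; w]) = blanks 0 (map Some x ++ None :: lw) [::].
  by rewrite encode2 /blanks /zip_tape cats0.
apply: reach_leq rr.
(* The called machine cannot output more than its input and running time allow, which keeps the loop
   over its queries polynomial. *)
have sq := size_output cw; rewrite -/N in sq.
have NE : N = size x + size w + 2.
  by rewrite /N encode2 size_cat /= size_cat /= !size_map; lia.
have nE : n = np + size w by rewrite /n size_cat size_nseq.
have nN : n <= np + N by rewrite nE NE; lia.
have b1 : (2 * n + 7) * size (encode (qs x w)) <= (2 * (np + N) + 7) * (N + T + 1).
  by apply: leq_mul => //; lia.
have b2 : size L * (2 * n + 3) <= size L * (2 * (np + N) + 3).
  by rewrite leq_mul2l; apply/orP; right; lia.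
have b3 : size (encode (shifted_queries x w)) <=
    (np + N + 2) * (N + T + 1) + size L * (np + N + 1).
  rewrite -outEq size_cat leq_add //.
    by apply: leq_trans (size_encode_shifted _ _) _; apply: leq_mul => //; lia.
  rewrite /e2; case: (fl) => //; rewrite size_encode_mealy.
  by rewrite leq_mul2l; apply/orP; right; lia.
rewrite -/N -/n /=; lia.
Qed.
End Queries.

Lemma shifted_queries_poly qs np S next out L :
    poly_time (fun xw : seq bool * seq bool => [:: xw.1; xw.2]) id
      (fun xw => qs xw.1 xw.2) ->
  poly_time (fun xw : seq bool * seq bool => [:: xw.1; xw.2]) id
    (fun xw => @shifted_queries qs np S next out L xw.1 xw.2).
Proof.
move=> [M [C [d h]]].
pose T N := C * N ^ d + C.
have pT : pbound T by apply: pbound_poly.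
apply: (@poly_timeP _ _ _ _ _ (wrapper M (qstart np L) (@qctl np S next out L))
  (fun N => 4 * N + 3 * np + T N + 20 + (2 * (np + N) + 7) * (N + T N + 1) +
      size L * (2 * (np + N) + 3) + (np + N + 2) * (N + T N + 1) + size L * (np + N + 1))).
  by repeat first [exact: pT | exact: pbound_id | exact: pbound_const
    | apply: pboundD | apply: pboundM].
by move=> [x w]; apply: reach_queries; apply: (h (x, w)).
Qed.

(** * The balance conditions *)

Section Address.
Variable b : nat.

(** The bits still to be output in place of the input, the generator for the remaining input, the
    class of the current index, and the last three bits read. *)
Definition ascan := ((8 + b).-bseq bool * option gen * 'I_6 * (bool * bool * bool))%type.

(* [gadj g j] depends on [j] only through its parity and, when [j < 4], its value. *)
Definition cls (n : nat) : 'I_6 := inord (if n < 4 then n else 4 + odd n).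

Lemma clsE n : cls n = (if n < 4 then n else 4 + odd n) :> nat.
Proof. by rewrite inordK //; case: (ltnP n 4) => h; [apply: leq_trans h _ | case: odd]. Qed.

Lemma cls_succ n : cls (cls n).+1 = cls n.+1.
Proof.
apply: val_inj; rewrite /= !clsE; case: (ltnP n 4) => n4.
  by [].
by rewrite (ltnNge n.+1) (leqW n4) /=; case: (odd n).
Qed.

Lemma gadj_cls g n h1 h3 : gadj g (cls n) h1 h3 = gadj g n h1 h3.
Proof.
rewrite /gadj clsE; case: (ltnP n 4) => // n4; rewrite oddD /=.
have c3 : gcoord g < 4 by rewrite /gcoord; case: g.1.2; case: g.2.
by rewrite oddb !(gtn_eqF (leq_trans c3 _)) // leq_addr.
Qed.

Definition anext (s : ascan) (c : bool) : ascan :=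
  let: (p, g, j, h) := s in
  if p is Bseq [::] _ then (p, g, cls j.+1, (c, h.1.1, h.1.2))
  else (insub_bseq _ (behead p), g, j, h).

Definition aout (s : ascan) (c : bool) : bool :=
  let: (p, g, j, h) := s in
  if p is Bseq (a :: _) _ then a
  else c (+) (if g is Some g' then gadj g' j h.1.1 h.2 else false).

Definition seed (p : seq bool) (g : option gen) : ascan :=
  (insub_bseq (8 + b) p, g, cls 0, (false, false, false)).

Definition oact (g : option gen) (v : seq bool) := if g is Some g' then gact g' v else v.

Lemma size_oact g v : size (oact g v) = size v.
Proof. by case: g => //= g; rewrite size_gact. Qed.

Lemma mealy_oact (p : (8 + b).-bseq bool) g n h1 h2 h3 v : p = [::] :> seq bool ->
  mealy anext aout (p, g, cls n, (h1, h2, h3)) v =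
  if g is Some g' then gscan g' n h1 h2 h3 v else v.
Proof.
case: p => -[|//] i _; elim: v n h1 h2 h3 => [|c v IH] n h1 h2 h3 /=; first by case: g.
by rewrite cls_succ IH; case: (g) => [g'|] /=; rewrite ?gadj_cls ?addbF.
Qed.

Lemma mealy_seed p g w : size p <= 8 + b ->
  mealy anext aout (seed p g) w = take (size w) (p ++ oact g (drop (size p) w)).
Proof.
rewrite /seed; elim: w p => [|c w IH] p le; first by rewrite take0.
have pE : insub_bseq (8 + b) p = p :> seq bool by rewrite /insub_bseq val_insubd le.
case: p le pE => [|a p] le pE.
  rewrite mealy_oact // drop0 /= take_oversize //.
  by rewrite -/(oact g (c :: w)) size_oact.
rewrite /=; have := IH p (ltnW le).
move: pE; case: (insub_bseq _ _) => -[|a' p'] i //= [-> ep].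
by rewrite ep => ->.
Qed.

(** The padding of ones is overwritten by [p] and the first [b] coins by [u]. The [take] cuts only
    when [w] is shorter than [b]; then the group of [w] is the empty word. *)
Lemma mealy_address p g u w : size p = 8 -> size u = b ->
  mealy anext aout (seed (p ++ u) g) (nseq 8 true ++ w) =
  p ++ take (size w) (u ++ oact g (drop b w)).
Proof.
move=> sp su; rewrite mealy_seed ?size_cat ?sp ?su // size_nseq.
rewrite drop_cat size_nseq ltnNge leq_addr /= addKn -catA take_cat sp ltnNge leq_addr /=.
by rewrite addKn.
Qed.

Lemma mealy_own p w : size p = 8 ->
  mealy anext aout (seed p None) (nseq 8 true ++ w) = p ++ w.
Proof.
move=> sp; rewrite mealy_seed ?sp ?leq_addr // drop_cat size_nseq ltnn subnn drop0.
by rewrite take_oversize // !size_cat size_nseq sp.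
Qed.
End Address.

(** * Grouping the coin strings and balancing the groups *)

Lemma drop_mem k b (u : b.-tuple bool) (v : (k - b).-tuple bool) : drop b (take k (u ++ v)) = v.
Proof.
have [bk|kb] := leqP b k.
  by rewrite take_oversize ?drop_size_cat ?size_cat ?size_tuple ?subnKC.
have v0 : v = [::] :> seq bool.
  by apply: size0nil; rewrite size_tuple; apply/eqP; rewrite subn_eq0 ltnW.
by rewrite v0 drop_oversize // cats0 size_take size_tuple kb ltnW.
Qed.

(** For [b <= k] the pairs enumerate the coin strings once; for [k < b] there is one group, in which
    each string occurs [2 ^ (b - k)] times. *)
Lemma sum_mem k b (h : seq bool -> nat) :
  \sum_(v : (k - b).-tuple bool) \sum_(u : b.-tuple bool) h (take k (u ++ v)) =
  2 ^ (b - k) * \sum_(w : k.-tuple bool) h w.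
Proof.
have [bk|kb] := leqP b k.
  rewrite (eqP bk) mul1n exchange_big /=.
  rewrite -[in RHS](subnKC bk) (big_tuple_cat _ b (k - b) h).
  apply: eq_bigr => u _; apply: eq_bigr => v _.
  by rewrite take_oversize // size_cat !size_tuple subnKC.
have kb0 : k - b = 0 by apply/eqP; rewrite subn_eq0 ltnW.
rewrite kb0 (big_tuple0 _ (fun v => \sum_(u : b.-tuple bool) h (take k (u ++ v)))).
rewrite -[in LHS](subnKC (ltnW kb)).
rewrite (big_tuple_cat _ k (b - k) (fun u => h (take k (u ++ [::])))) big_distrr.
apply: eq_bigr => u _ /=.
rewrite (eq_bigr (fun=> h u)) => [|u' _]; last by rewrite cats0 take_size_cat ?size_tuple.
by rewrite sum_nat_const card_tuple card_bool.
Qed.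

Section Balance.
Variables (k b theta : nat) (zb : seq bool -> bool) (tb : seq bool -> seq bool -> bool).

Definition supply (v : seq bool) : nat := \sum_(u : b.-tuple bool) zb (take k (u ++ v)).
Definition outflow (v : seq bool) : nat :=
  \sum_(i : 7.-tuple bool) \sum_(u : b.-tuple bool) tb i (take k (u ++ v)).
Definition inflow (v : seq bool) : nat :=
  \sum_(i : 7.-tuple bool) \sum_(u : b.-tuple bool) tb i (take k (u ++ gact (gen_of i) v)).
Definition balanced (v : seq bool) : bool := theta + outflow v <= supply v + inflow v.

Lemma sum_inflow :
  \sum_(v : (k - b).-tuple bool) inflow v = \sum_(v : (k - b).-tuple bool) outflow v.
Proof.
rewrite /inflow /outflow exchange_big [RHS]exchange_big; apply: eq_bigr => i _ /=.
by rewrite [RHS](reindex_inj (inv_inj (gact_tupleK (gen_of i)))).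
Qed.

Lemma outflow_le v : outflow v <= 128 * 2 ^ b.
Proof.
have -> : 128 * 2 ^ b = \sum_(i : 7.-tuple bool) \sum_(u : b.-tuple bool) 1.
  rewrite (eq_bigr (fun=> 2 ^ b)) => [|i _]; first by rewrite sum_nat_const card_tuple card_bool.
  by rewrite sum1_card card_tuple card_bool.
by do 2 apply: leq_sum => ? _; case: (tb _ _).
Qed.

(** Net inflows cancel in the sum over the groups. The factor 130 charges a rejecting string 129 for
    an unbalanced group and 1 for a claim [zb w] that [acc] refutes. *)
Lemma balance_sound (acc : seq bool -> bool) : theta <= 2 ^ b ->
  theta * 2 ^ (k - b) <= 2 ^ (b - k) * (\sum_(w : k.-tuple bool) acc w +
    130 * \sum_(w : k.-tuple bool) ~~ ((zb w ==> acc w) && balanced (drop b w))).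
Proof.
move=> tb_le; set rej := \sum_(w : k.-tuple bool) ~~ _.
(* An unbalanced group falls short by at most [theta + outflow v <= 129 * 2 ^ b], which is 129 for
   each of its [2 ^ b] members. *)
have step1 : theta * 2 ^ (k - b) + \sum_(v : (k - b).-tuple bool) outflow v <=
    \sum_(v : (k - b).-tuple bool) supply v + \sum_(v : (k - b).-tuple bool) inflow v +
    129 * \sum_(v : (k - b).-tuple bool) \sum_(u : b.-tuple bool) ~~ balanced v.
  have -> : theta * 2 ^ (k - b) = \sum_(v : (k - b).-tuple bool) theta.
    by rewrite sum_nat_const card_tuple card_bool mulnC.
  rewrite big_distrr -!big_split; apply: leq_sum => v _ /=.
  rewrite sum_nat_const card_tuple card_bool.
  have [ok|/= _] := boolP (balanced v); first by apply: leq_trans ok _; rewrite leq_addr.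
  rewrite muln1 (leq_trans _ (leq_addl _ _)) // (mulnDl 1 128) mul1n.
  exact: leq_add (outflow_le v).
have step2 : \sum_(v : (k - b).-tuple bool) supply v <=
    2 ^ (b - k) * (\sum_(w : k.-tuple bool) acc w + rej).
  rewrite (sum_mem k b (fun w => zb w)) leq_mul2l -big_split; apply/orP; right.
  by apply: leq_sum => w _; case: (zb w); case: (acc w).
have step3 : \sum_(v : (k - b).-tuple bool) \sum_(u : b.-tuple bool) ~~ balanced v <=
    2 ^ (b - k) * rej.
  rewrite (eq_bigr (fun v : (k - b).-tuple bool => \sum_(u : b.-tuple bool)
      ~~ balanced (drop b (take k (u ++ v))))) => [|v _]; last first.
    by apply: eq_bigr => u _; rewrite drop_mem.
  rewrite (sum_mem k b (fun w => ~~ balanced (drop b w))) leq_mul2l; apply/orP; right.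
  by apply: leq_sum => w _; case: (balanced _); rewrite ?andbF.
move: step1; rewrite sum_inflow.
move: (\sum_(v : (k - b).-tuple bool) outflow v) step2 step3 => o step2 step3 step1.
have := leq_mul (leqnn 129) step3.
rewrite mulnDr in step2 *; lia.
Qed.
End Balance.

Lemma balance_complete k b theta (acc : seq bool -> bool) : theta <= 2 ^ b ->
    theta * 2 ^ (k - b) <= 2 ^ (b - k) * \sum_(w : k.-tuple bool) acc w ->
  exists tb, forall v : (k - b).-tuple bool, balanced k b theta acc tb v.
Proof.
move=> tb_le le; have [bk|kb] := leqP b k; last first.
  (* With a single group the hypothesis is already the balance condition, so no token moves. *)
  exists (fun _ _ => false) => v.
  have v0 : v = [::] :> seq bool.
    by apply: size0nil; rewrite size_tuple; apply/eqP; rewrite subn_eq0 ltnW.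
  rewrite /balanced /outflow big1 => [|i _]; last by rewrite big1.
  rewrite addn0 (leq_trans _ (leq_addr _ _)) // v0.
  move: le; rewrite -(sum_mem k b (fun w => acc w)).
  have kb0 : k - b = 0 by apply/eqP; rewrite subn_eq0 ltnW.
  by rewrite kb0 (big_tuple0 _ (fun v => \sum_(u : b.-tuple bool) acc (take k (u ++ v)))) muln1.
rewrite -(sum_mem k b (fun w => acc w)) in le.
have [|beta hb] := expander_flow (f := fun v : (k - b).-tuple bool => supply k b acc v) _ tb_le le.
  move=> v; have -> : 2 ^ b = \sum_(u : b.-tuple bool) 1.
    by rewrite sum1_card card_tuple card_bool.
  by apply: leq_sum => u _; case: (acc _).
(* The flow is indexed by tuples; [tup] reads it off arbitrary strings and is exact on strings of
   the right length. *)
pose tup n (s : seq bool) : n.-tuple bool := insubd [tuple of nseq n false] s.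
have tupK n (t : n.-tuple bool) : tup n t = t by rewrite /tup valKd.
exists (fun i w => beta (tup 7 i) (tup b (take b w)) (tup (k - b) (drop b w))) => v.
have ev i (u : b.-tuple bool) (y : (k - b).-tuple bool) :
    beta (tup 7 (tval i)) (tup b (take b (take k (u ++ y)))) (tup (k - b) (drop b (take k (u ++ y)))) =
    beta i u y.
  rewrite drop_mem !tupK (@take_oversize _ k) ?size_cat ?size_tuple ?subnKC //.
  by rewrite take_size_cat ?size_tuple // tupK.
apply: leq_trans (leq_trans (hb v) _); rewrite leq_add2l.
  by do 2 (apply: leq_sum => ? _); rewrite ev.
by apply: leq_sum => i _; apply: leq_sum => u _; rewrite (ev i u (gact_tuple (gen_of i) v)).
Qed.

(** * The new verifier *)

Lemma position_lt a : position a < 2 ^ size a.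
Proof. by elim: a => //= c a IH; rewrite expnS; case: c; lia. Qed.

(** Inverse of [position] on strings of length [n]; it turns a proof position back into an
    address. *)
Fixpoint bits (n p : nat) : seq bool := if n is n'.+1 then odd p :: bits n' p./2 else [::].

Lemma bits_position a : bits (size a) (position a) = a.
Proof.
elim: a => //= c a IH; rewrite oddD odd_double addbF oddb; congr (_ :: _).
by rewrite half_bit_double.
Qed.

Lemma count_enum (T : finType) (F : T -> bool) : count id [seq F t | t <- enum T] = \sum_t F t.
Proof.
rewrite count_map -sum1_count big_mkcond big_enum /=.
by apply: eq_bigr => t _ /=; case: (F t).
Qed.

Section NewVerifier.
Variables (b : nat) (theta : nat -> nat) (V : verifier).
Hypothesis b_gt0 : 0 < b.

(* The new bits are addressed by an 8-bit prefix followed by the k bits of w: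
   [zprefix] for z_w, and [tprefix i] for the direction of token i of w. *)
Definition zprefix := true :: nseq 7 false.
Definition tprefix (i : seq bool) := false :: i.

Definition zseeds : seq (ascan b) := [seq seed b (zprefix ++ tval u) None | u <- enum {: b.-tuple bool}].
Definition oseeds : seq (ascan b) :=
  [seq seed b (tprefix (tval iu.1) ++ tval iu.2) None | iu <- enum {: 7.-tuple bool * b.-tuple bool}].
Definition iseeds : seq (ascan b) :=
  [seq seed b (tprefix (tval iu.1) ++ tval iu.2) (Some (gen_of iu.1))
  | iu <- enum {: 7.-tuple bool * b.-tuple bool}].
Definition seeds := seed b zprefix None :: zseeds ++ oseeds ++ iseeds.

Definition pops (m : nat) := if m == 0 then 0 else size seeds.

(** For [m = 0] the decision of [V] stands. Otherwise [e] lists, in the order of [seeds], the bit of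
    [w], the bits of its group, the directions of the group's own tokens, and those of the tokens
    that neighbours may send. *)
Definition verdict (m : nat) (e : seq bool) (d : bool) : bool :=
  (m == 0) && d ||
  [&& m != 0, head false e ==> d &
   let e' := behead e in
   theta m + count id (take (size oseeds) (drop (size zseeds) e')) <=
   count id (take (size zseeds) e') + count id (drop (size zseeds + size oseeds) e')].

Definition new_verifier : verifier :=
  Verifier (coins V)
    (shifted_queries (queries V) 8 (@anext b) (@aout b) seeds)
    (pop_decide (decide V) b pops verdict).

Lemma new_verifier_efficient : efficient V -> efficient new_verifier.
Proof.
case=> h1 h2 h3; split=> //; first exact: shifted_queries_poly.
apply: (@pop_decide_poly _ _ (size seeds)) => // m.
by rewrite /pops; case: ifP.
Qed.

Definition ans (pi a : seq bool) : bool := nth false pi (position a).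

Lemma size_extra w s : s \in [seq mealy (@anext b) (@aout b) s (nseq 8 true ++ w) | s <- seeds] ->
  size s = 8 + size w.
Proof. by case/mapP => s' _ ->; rewrite size_mealy size_cat size_nseq. Qed.

Lemma ans_shifted pi n l :
  map (ans pi) (map (add_pow n) l) = map (ans (drop (2 ^ n) pi)) l.
Proof.
rewrite -map_comp; apply: eq_map => a /=.
by rewrite /ans position_add_pow nth_drop addnC.
Qed.

Lemma acceptsE U x pi w : accepts U x pi w = decide U x w (map (ans pi) (queries U x w)).
Proof. by []. Qed.

Lemma accepts_nil x pi :
  accepts new_verifier x pi [::] = accepts V x (drop (2 ^ 8) pi) [::].
Proof.
rewrite acceptsE -[queries _ _ _]/(map (add_pow 8) (queries V x [::]) ++ [::]).
rewrite cats0 ans_shifted -[decide _]/(pop_decide (decide V) b pops verdict).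
by rewrite /pop_decide /= /verdict min0n /= orbF /pops /= subn0 take_size.
Qed.

Lemma accepts_new x pi w : 0 < size w ->
  let k := size w in
  let zb y := ans pi (zprefix ++ y) in
  let tb i y := ans pi (tprefix i ++ y) in
  accepts new_verifier x pi w =
  (zb w ==> accepts V x (drop (2 ^ (8 + k)) pi) w) &&
  balanced k b (theta (minn k b)) zb tb (drop b w).
Proof.
move=> k0 k zb tb; rewrite !acceptsE /= /shifted_queries.
have -> : nilp w = false by case: (w) k0.
rewrite map_cat ans_shifted /pop_decide.
set m := minn _ _; have m0 : (m == 0) = false by rewrite /m; lia.
set qa := map (ans _) (queries V x w); set e := map (ans pi) (map _ seeds).
have se : size e = size seeds by rewrite !size_map.
rewrite /pops m0 size_cat se addnK take_size_cat // drop_size_cat //.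
rewrite /verdict m0 andFb orFb andTb.
have -> : e = zb w ::
    [seq zb (take k (tval u ++ drop b w)) | u <- enum {: b.-tuple bool}] ++
    [seq tb (tval iu.1) (take k (tval iu.2 ++ drop b w))
      | iu <- enum {: 7.-tuple bool * b.-tuple bool}] ++
    [seq tb (tval iu.1) (take k (tval iu.2 ++ gact (gen_of iu.1) (drop b w)))
      | iu <- enum {: 7.-tuple bool * b.-tuple bool}].
  rewrite /e /seeds !map_cons mealy_own //.
  congr (_ :: _); rewrite !map_cat -!map_comp; congr (_ ++ (_ ++ _)).
  - by apply: eq_map => u; rewrite /comp mealy_address ?size_tuple.
  - by apply: eq_map => iu; rewrite /comp mealy_address /= ?size_tuple.
  - by apply: eq_map => iu; rewrite /comp mealy_address /= ?size_tuple.
rewrite /= /zseeds /oseeds !size_map.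
rewrite take_size_cat ?size_map // drop_size_cat ?size_map // take_size_cat ?size_map //.
rewrite [X in drop X (_ ++ _)]addnC -drop_drop drop_size_cat ?size_map // drop_size_cat ?size_map //.
rewrite !count_enum /balanced /supply /outflow /inflow.
by rewrite !pair_bigA.
Qed.

Lemma new_restricted r q : restricted V r q ->
  restricted new_verifier r (fun n => q n + size seeds * r n).
Proof.
move=> h x; have [kr hq] := h x; split=> // w /=.
rewrite /shifted_queries size_cat size_map; apply: leq_add; first exact: hq.
(* Extra queries occur only if at least one coin is tossed, so [size seeds] is at most [size seeds]
   times the coin bound. *)
case: ifP => // w0; rewrite size_map -[leqLHS]muln1 leq_mul2l; apply/orP; right.
apply: leq_trans kr; rewrite lt0n; apply: contraFneq w0 => k0.
by rewrite /nilp size_tuple [coins _ _]k0.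
Qed.

Lemma pow_offset r q x : restricted V r q ->
  2 ^ (8 + coins V x) <= 256 * 2 ^ r (size x).
Proof.
by move=> /(_ x)[kr _]; rewrite expnD leq_mul2l leq_pexp2l ?orbT.
Qed.

Lemma new_proof_size r q ell : restricted V r q -> has_proof_size V ell ->
  has_proof_size new_verifier (fun n => ell n + 256 * 2 ^ r n).
Proof.
move=> hr he x w a; have := pow_offset x hr; rewrite /= /shifted_queries mem_cat.
move=> off /orP[/mapP[a' aq ->]|].
  by rewrite position_add_pow size_tuple -addSn leq_add //; apply: he aq.
case: ifP => // _ /size_extra sa; apply: leq_trans (position_lt a) _.
by rewrite sa size_tuple (leq_trans off) // leq_addl.
Qed.

Lemma eq_accepts x w pi pi' :
    (forall a, a \in queries V x w -> ans pi a = ans pi' a) ->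
  accepts V x pi w = accepts V x pi' w.
Proof. by move=> e; rewrite !acceptsE; congr (decide _ _ _ _); apply/eq_in_map. Qed.

Lemma new_complete r q ell x pi :
    restricted V r q -> has_proof_size V ell -> size pi = ell (size x) ->
    let k := coins V x in
    let acc := \sum_(w : k.-tuple bool) accepts V x pi w in
    0 < acc ->
    theta (minn k b) <= 2 ^ b -> theta (minn k b) * 2 ^ (k - b) <= 2 ^ (b - k) * acc ->
  exists2 pi', size pi' = ell (size x) + 256 * 2 ^ r (size x) &
    forall w : k.-tuple bool, accepts new_verifier x pi' w.
Proof.
move=> hr he spi k acc acc0 tb2 tle.
have [tb htb] := balance_complete (acc := fun w => accepts V x pi w) tb2 tle.
(* The honest proof: the claim for [w] is the true verdict of [V], and the token directions come
   from the balancing flow [tb]. *)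
pose cont a := if head false a then accepts V x pi (drop 8 a) else tb (take 7 (behead a)) (drop 8 a).
pose ext := mkseq (fun p => cont (bits (8 + k) p)) (2 ^ (8 + k)).
have sext : size ext = 2 ^ (8 + k) by rewrite size_mkseq.
have off := pow_offset x hr; rewrite -/k in off.
(* The coins actually tossed may be fewer than [r] allows, so the proof is padded to the uniform
   length. *)
pose pi' := ext ++ pi ++ nseq (256 * 2 ^ r (size x) - 2 ^ (8 + k)) false.
have ansE a : size a = 8 + k -> ans pi' a = cont a.
  move=> sa; have lt := position_lt a; rewrite sa in lt.
  by rewrite /ans nth_cat sext lt nth_mkseq // -sa bits_position.
exists pi'.
  by rewrite !size_cat sext spi size_nseq addnCA subnKC.
have accE (w : k.-tuple bool) : accepts V x (drop (2 ^ (8 + k)) pi') w = accepts V x pi w.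
  apply: eq_accepts => a /he lt.
  by rewrite /ans /pi' -sext drop_size_cat // nth_cat spi lt.
move=> w; have [k0|k0] := posnP k.
  have w0 : tval w = [::] by apply: size0nil; rewrite size_tuple.
  rewrite w0 accepts_nil; move: (accE w); rewrite w0 k0 => ->.
  (* Without coins there is one outcome, which [0 < acc] makes accepting. *)
  move: acc0; rewrite /acc k0.
  by rewrite (big_tuple0 _ (fun w => accepts V x pi w : nat)); case: accepts.
rewrite accepts_new size_tuple // accE.
have -> : ans pi' (zprefix ++ w) = accepts V x pi w.
  by rewrite ansE ?size_cat ?size_tuple // /cont /= drop0.
rewrite implybb /=.
have sv : size (drop b w) == k - b by rewrite size_drop size_tuple.
have := htb (Tuple sv); rewrite /balanced /supply /outflow /inflow /=.
have sz (u : b.-tuple bool) g : size (take k (u ++ oact g (drop b w))) = k.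
  by rewrite size_takel // size_cat size_oact size_drop !size_tuple -leq_subLR.
congr (_ <= _); congr (_ + _).
- apply: eq_bigr => i _; apply: eq_bigr => u _.
  rewrite ansE /=; last by rewrite size_cat size_tuple (sz _ None).
  by rewrite /cont /= (@take_size_cat _ 7) ?(@drop_size_cat _ 7) ?size_tuple.
- apply: eq_bigr => u _; rewrite ansE; last by rewrite /= (sz _ None).
  by rewrite /cont /= drop0.
- apply: eq_bigr => i _; apply: eq_bigr => u _.
  rewrite ansE /=; last by rewrite size_cat size_tuple (sz _ (Some _)).
  by rewrite /cont /= (@take_size_cat _ 7) ?(@drop_size_cat _ 7) ?size_tuple.
Qed.

Lemma new_sound r q ell x pi' :
    restricted V r q -> has_proof_size V ell ->
    size pi' = ell (size x) + 256 * 2 ^ r (size x) ->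
    theta (minn (coins V x) b) <= 2 ^ b ->
  exists2 pi, size pi = ell (size x) &
    let k := coins V x in
    let acc := \sum_(w : k.-tuple bool) accepts V x pi w in
    let rej := \sum_(w : k.-tuple bool) ~~ accepts new_verifier x pi' w in
    (k = 0 -> rej + acc = 1) /\
    (0 < k -> theta (minn k b) * 2 ^ (k - b) <= 2 ^ (b - k) * (acc + 130 * rej)).
Proof.
move=> hr he spi tb2; have off := pow_offset x hr.
(* The proof for [V] is the segment of length [ell (size x)] behind the new bits. *)
pose k := coins V x; pose pi := take (ell (size x)) (drop (2 ^ (8 + k)) pi').
have spi' : size pi = ell (size x).
  by rewrite size_takel // size_drop spi -addnBA // leq_addr.
have accE (w : k.-tuple bool) : accepts V x (drop (2 ^ (8 + k)) pi') w = accepts V x pi w.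
  by apply: eq_accepts => a /he lt; rewrite /ans /pi nth_take.
exists pi => //; cbv zeta; rewrite -/k; split=> [k0|k0].
  move: accE; rewrite k0 => accE.
  rewrite (big_tuple0 _ (fun w => ~~ accepts new_verifier x pi' w : nat)).
  rewrite (big_tuple0 _ (fun w => accepts V x pi w : nat)) accepts_nil.
  by rewrite (accE [tuple]); case: accepts.
pose zb y := ans pi' (zprefix ++ y); pose tb i y := ans pi' (tprefix i ++ y).
apply: leq_trans (balance_sound k zb tb (fun w => accepts V x pi w) tb2) _.
rewrite leq_mul2l leq_add2l leq_mul2l; do 2 (apply/orP; right).
apply/eq_leq/eq_bigr => w _; congr (nat_of_bool (~~ _)).
by rewrite accepts_new size_tuple // accE.
Qed.
End NewVerifier.

(** * Choice of the threshold and the soundness gap *)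

Local Open Scope ring_scope.

Lemma acceptance_probE (R : realType) V x pi :
  acceptance_prob R V x pi =
  (\sum_(w : (coins V x).-tuple bool) accepts V x pi w)%:R / 2 ^+ coins V x.
Proof.
by rewrite /acceptance_prob -sum1dep_card big_mkcond; congr (_%:R / _).
Qed.

(** For [m >= b] the threshold is the floor of [c * 2 ^+ b]; [b] is so large that rounding loses at
    most half of the gap between [s] and [c]. For [m < b] it is the ceiling of [c * 2 ^+ m], scaled
    by [2 ^ (b - m)] to match the repetitions in the single group. *)
Lemma threshold (R : realType) (c s : R) : 0 < c < 1 -> s < c ->
  exists b (theta : nat -> nat), [/\ (0 < b)%N,
    forall m, (theta m <= 2 ^ b)%N,
    forall m, (s + (c - s) / 2) * 2 ^+ b <= (theta m)%:R &
    forall k A, c * 2 ^+ k <= A%:R -> (theta (minn k b) * 2 ^ (k - b) <= 2 ^ (b - k) * A)%N].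
Proof.
move=> /andP[c0 c1] sc.
have [b b0 hb] : exists2 b, (0 < b)%N & 1 <= (c - s) / 2 * 2 ^+ b.
  have d0 : 0 < (c - s) / 2 by rewrite divr_gt0 // subr_gt0.
  exists (Num.bound ((c - s) / 2)^-1).+1 => //.
  rewrite -ler_pdivrMl // mulr1; apply: ltW; apply: lt_trans (archi_boundP _) _.
    by rewrite invr_ge0 ltW.
  by rewrite -natrX ltr_nat (leq_trans _ (ltn_expl _ _)).
have ex m : exists n, c * 2 ^+ m <= n%:R.
  by exists (2 ^ m)%N; rewrite natrX ler_piMl ?exprn_ge0 // ltW.
have ex' : exists n, c * 2 ^+ b < n.+1%:R.
  have [n hn] := ex b; exists n; apply: le_lt_trans hn _.
  by rewrite ltr_nat.
pose ceil m := ex_minn (ex m); pose fl := ex_minn ex'.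
have ceil_ge m : c * 2 ^+ m <= (ceil m)%:R by rewrite /ceil; case: ex_minnP.
have ceil_le m n : c * 2 ^+ m <= n%:R -> (ceil m <= n)%N.
  by rewrite /ceil; case: ex_minnP => j _; apply.
have fl_lt : c * 2 ^+ b < fl.+1%:R by rewrite /fl; case: ex_minnP.
have fl_le : fl%:R <= c * 2 ^+ b.
  rewrite /fl; case: ex_minnP => -[|n] _ hn; first by rewrite mulr_ge0 ?exprn_ge0 // ltW.
  rewrite leNgt; apply/negP => /hn; rewrite ltnn //.
exists b, (fun m => if (m < b)%N then (2 ^ (b - m) * ceil m)%N else fl); split=> // [m|m|k A hA].
- case: ifP => mb.
    rewrite -{2}(subnK (ltnW mb)) expnD leq_mul2l; apply/orP; right.
    by apply: ceil_le; rewrite natrX ler_piMl ?exprn_ge0 // ltW.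
  rewrite -(ler_nat R) natrX; apply: le_trans fl_le _.
  by rewrite ler_piMl ?exprn_ge0 // ltW.
- case: ifP => mb.
    have -> : 2 ^+ b = 2 ^+ (b - m) * 2 ^+ m :> R by rewrite -exprD subnK // ltnW.
    have := ceil_ge m; rewrite natrM natrX.
    have p1 : 0 < 2 ^+ (b - m) :> R by rewrite exprn_gt0.
    have p2 : 0 < 2 ^+ m :> R by rewrite exprn_gt0.
    move: (2 ^+ (b - m)) (2 ^+ m) (ceil m)%:R p1 p2 => X Y Z X0 Y0 h.
    rewrite mulrCA ler_pM2l //; apply: le_trans h; rewrite ler_pM2r //; lra.
  have -> : (s + (c - s) / 2) * 2 ^+ b = c * 2 ^+ b - (c - s) / 2 * 2 ^+ b by field.
  rewrite lerBlDr; apply: ltW; apply: lt_le_trans fl_lt _.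
  by rewrite -addn1 natrD lerD2l.
- have [kb|bk] := ltnP k b.
    rewrite kb (eqP (ltnW kb)) muln1 leq_mul2l; apply/orP; right.
    exact: ceil_le.
  rewrite ltnn (eqP bk) mul1n -(ler_nat R); apply: le_trans hA.
  rewrite natrM natrX -{2}(subnKC bk) exprD mulrA ler_pM2r //.
  by rewrite exprn_gt0.
Qed.

Lemma card_tuples_sum k (P : k.-tuple bool -> bool) :
  (\sum_w P w + \sum_w ~~ P w = 2 ^ k)%N.
Proof.
rewrite -big_split /= (eq_bigr (fun=> 1%N)); last by move=> w _; case: (P w).
by rewrite sum1_card card_tuple card_bool.
Qed.

(* [B] is the constant of O(2^r), and [K] that of O_{s,c}(r). *)
Theorem theorem1 (R : realType) :
  exists B : nat,
  forall c s : R, 0 < c < 1 -> 0 < s < 1 -> s < c ->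
  exists2 s' : R, 0 < s' < 1 &
  exists K : nat,
  forall r q : nat -> nat,
    (forall L : language,
       PCP (fun=> c) (fun=> s) r q L ->
       PCP (fun=> 1) (fun=> s') r (fun n => (q n + K * r n)%N) L) /\
    (forall (ell : nat -> nat) (L : language),
       PCP_size (fun=> c) (fun=> s) r q ell L ->
       exists2 ell' : nat -> nat,
         (forall n, (ell' n <= ell n + B * 2 ^ r n)%N) &
         PCP_size (fun=> 1) (fun=> s') r (fun n => (q n + K * r n)%N) ell' L).
Proof.
(* [256 = 2 ^ 8] comes from the 8-bit address prefix. *)
exists 256%N => c s c01 /andP[s0 s1] sc.
have [b [theta [b0 th_le th_ge th_c]]] := threshold c01 sc.
case/andP: c01 => c0 c1.
(* Soundness gives [(s + (c - s) / 2) * 2 ^+ k <= acc + 130 * rej] with [acc <= s * 2 ^+ k], so the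
   rejecting fraction is at least [(c - s) / 2 / 130]. *)
exists (1 - (c - s) / 260); first by apply/andP; split; lra.
exists (size (seeds b)) => r q.
suff main (ell : nat -> nat) (L : language) : PCP_size (fun=> c) (fun=> s) r q ell L ->
    PCP_size (fun=> 1) (fun=> 1 - (c - s) / 260) r (fun n => (q n + size (seeds b) * r n)%N)
      (fun n => (ell n + 256 * 2 ^ r n)%N) L.
  split=> [L [ell /main h]|ell L /main h]; first by exists (fun n => (ell n + 256 * 2 ^ r n)%N).
  by exists (fun n => (ell n + 256 * 2 ^ r n)%N).
case=> V [eff res ps comp sound].
exists (new_verifier b theta V); split.
- exact: new_verifier_efficient.
- exact: new_restricted.
- exact: new_proof_size res ps.
- move=> x /comp[pi spi]; rewrite acceptance_probE.
  set k := coins V x; set acc := (\sum_w _)%N => hacc.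
  have p2 : 0 < 2 ^+ k :> R by rewrite exprn_gt0.
  rewrite ler_pdivlMr // in hacc.
  have acc0 : (0 < acc)%N.
    by rewrite -(ltr_nat R); apply: lt_le_trans hacc; rewrite mulr_gt0.
  have [pi' spi' hpi'] := new_complete b0 res ps spi acc0 (th_le _) (th_c _ _ hacc).
  exists pi' => //; rewrite acceptance_probE -[coins _ x]/k.
  rewrite (_ : (\sum_w _)%N = (2 ^ k)%N); first by rewrite natrX divff // lt0r_neq0.
  rewrite (eq_bigr (fun=> 1%N)) => [|w _]; last by rewrite hpi'.
  by rewrite sum1_card card_tuple card_bool.
- move=> x /sound hs pi' spi'.
  have [pi spi [h0 h1]] := new_sound b0 res ps spi' (th_le _).
  move: (hs pi spi); rewrite !acceptance_probE -[coins (new_verifier _ _ _) x]/(coins V x).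
  have := card_tuples_sum (fun w : (coins V x).-tuple bool =>
    accepts (new_verifier b theta V) x pi' w).
  move: h0 h1; set k := coins V x; set acc := (\sum_(w : k.-tuple bool) accepts V x pi w)%N.
  set rej := (\sum_(w : k.-tuple bool) ~~ _)%N; set acc' := (\sum_(w : k.-tuple bool) _)%N.
  move=> h0 h1 tot hacc.
  have p2 : 0 < 2 ^+ k :> R by rewrite exprn_gt0.
  rewrite ler_pdivrMr // in hacc; rewrite ler_pdivrMr //.
  have totR : acc'%:R + rej%:R = 2 ^+ k :> R by rewrite -natrD tot natrX.
  have [k0|k0] := posnP k.
    have := h0 k0; rewrite k0 expr0 mulr1 in hacc totR *.
    (* With one outcome the acceptance probability of [V] is 0 or 1, and [s < 1] leaves only 0. *)
    case: (acc) hacc => [|n] hacc; last first.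
      by exfalso; move: hacc; rewrite leNgt => /negP[]; apply: lt_le_trans s1 _; rewrite ler1n.
    rewrite addn0 => rej1; rewrite rej1 in totR; lra.
  have := h1 k0; rewrite -(ler_nat R) !natrM natrD natrM !natrX => hle.
  have := th_ge (minn k b); move: (theta _)%:R hle => t hle tge.
  (* Both truncated differences occur, one of them being 0, so this covers [k < b] and [b <= k] at
     once. *)
  have e : 2 ^+ b * 2 ^+ (k - b) = 2 ^+ (b - k) * 2 ^+ k :> R.
    by rewrite -!exprD; congr (_ ^+ _); lia.
  have q1 : 0 < 2 ^+ (b - k) :> R by rewrite exprn_gt0.
  have q2 : 0 < 2 ^+ (k - b) :> R by rewrite exprn_gt0.
  have : (s + (c - s) / 2) * 2 ^+ k <= acc%:R + 130 * rej%:R.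
    rewrite -(ler_pM2l q1); apply: le_trans hle.
    by rewrite mulrCA -e mulrA ler_pM2r.
  move: hacc totR; move: (2 ^+ k) p2 => X X0; nra.
Qed.
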